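(* Let $k,j$ be positive integers with $j\le k$, and let $0\le p<p_c=\bar p_c$, where $p_c$ and $\bar p_c$ are the (coinciding) critical densities of the FA-jf model on $\mathbb{T}^k$ and of the OFA-jf model on $\bar{\mathbb{T}}^k$. Let $\mathcal{L}$ and $\bar{\mathcal{L}}$ be the generators at density $p$ of the FA-jf model on $\mathbb{T}^k$ and of the OFA-jf model on $\bar{\mathbb{T}}^k$, respectively. Then $\operatorname{gap}(\mathcal{L})>0$ and $\operatorname{gap}(\bar{\mathcal{L}})>0$.
   Context: $\mathbb{T}^k$ is the infinite regular unrooted tree in which every vertex has exactly $k+1$ neighbors. $\bar{\mathbb{T}}^k$ is the infinite rooted $k$-ary tree: the root $r$ has $k$ children (and no ancestor), and every other vertex has $k$ children and one ancestor (parent). For a vertex $x$, $\mathcal{N}_x$ is the set of its neighbors, and, in the rooted case, $\mathcal{K}_x$ is the set of its children. Let $V$ be the vertex set of the tree under consideration, $\Omega=\{0,1\}^V$ (value $1$ = occupied, $0$ = empty). For $p\in[0,1]$ let $\mu=\bigotimes_{x\in V}\mu_x$ be the product measure on $\Omega$ with $\mu_x(1)=p$, $\mu_x(0)=q=1-p$. For a local function $f:\Omega\to\mathbb{R}$ (depending on finitely many variables), $\mu_x(f)(\omega)$ denotes the average of $f$ over the variable at $x$ with respect to $\mu_x$, the other variables being fixed equal to those of $\omega$. The FA-jf model on $\mathbb{T}^k$ and the OFA-jf model on $\bar{\mathbb{T}}^k$ at density $p$ are the continuous time Markov processes on $\Omega$, reversible with respect to $\mu$, whose generators act on local functions as $$\mathcal{L}f(\omega)=\sum_{x\in\mathbb{T}^k}c_x(\omega)[\mu_x(f)(\omega)-f(\omega)],\qquad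 \bar{\mathcal{L}}f(\omega)=\sum_{x\in\bar{\mathbb{T}}^k}\bar c_x(\omega)[\mu_x(f)(\omega)-f(\omega)],$$ where $c_x(\omega)=1$ if $\sum_{y\in\mathcal{N}_x}(1-\omega_y)\ge j$ and $c_x(\omega)=0$ otherwise, and $\bar c_x(\omega)=1$ if $\sum_{y\in\mathcal{K}_x}(1-\omega_y)\ge j$ and $\bar c_x(\omega)=0$ otherwise. These generators extend to non-positive self-adjoint operators on $L^2(\Omega,\mu)$, still denoted $\mathcal{L},\bar{\mathcal{L}}$. The critical densities are $$p_c=\sup\{p\in[0,1):\ 0\text{ is a simple eigenvalue of }\mathcal{L}\},\qquad \bar p_c=\sup\{p\in[0,1):\ 0\text{ is a simple eigenvalue of }\bar{\mathcal{L}}\};$$ for given $k,j$ they coincide. The spectral gap is $$\operatorname{gap}(\mathcal{L}):=\inf_{f\in\operatorname{Dom}(\mathcal{L}),\ f\ne\mathrm{const}}\frac{\mathcal{D}(f)}{\operatorname{Var}(f)},\qquad \mathcal{D}(f)=\mu(f\,(-\mathcal{L}f)),$$ where $\operatorname{Var}(f)=\mu(f^2)-\mu(f)^2$ and ''$f\neq$ const'' is meant in $L^2(\Omega,\mu)$ (the infimum of the empty set being $+\infty$); analogously for $\operatorname{gap}(\bar{\mathcal{L}})$. *)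

(* Defs.v *)
From HB Require Import structures.
From mathcomp Require Import all_boot all_order all_algebra.
From mathcomp Require Import all_classical all_reals all_analysis.
From mathcomp Require Import ring lra.

Set Implicit Arguments.
Unset Strict Implicit.
Unset Printing Implicit Defensive.

Import Order.TTheory GRing.Theory Num.Theory.
Import numFieldNormedType.Exports.

Local Open Scope classical_set_scope.
Local Open Scope ring_scope.

(* Configurations, [true] = occupied = 1, with the product sigma-algebra. *)
Definition config (V : Type) : Type :=
  g_sigma_algebraType [set A : set (V -> bool) |
    exists x : V, A = [set w | w x]].

(* Existence of the product measure: uniform random variable on [0, 1], whose
   digits are read off by repeatedly cutting an interval in proportion
   p : 1 - p. *)
Section product_measure_exists.
Context (R : realType) (p : R).
Hypothesis p01 : 0 <= p <= 1.

Fixpoint cell (s : seq bool) : R * R :=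
  if s is b :: s' then
    let: (a, l) := cell s' in
    if b then (a, l * p) else (a + l * p, l * (1 - p))
  else (0, 1).

Definition cell_cut (s : seq bool) : R := (cell s).1 + (cell s).2 * p.

Fixpoint bits (n : nat) (u : R) : seq bool :=
  if n is n'.+1 then (u < cell_cut (bits n' u)) :: bits n' u else [::].

Definition digit (n : nat) (u : R) : bool := u < cell_cut (bits n u).

Lemma measurable_bits (n : nat) (E : seq bool -> set R) :
  (forall s, measurable (E s)) -> measurable [set u | E (bits n u) u].
Proof.
elim: n E => [|n IHn] E mE /=; first exact: mE.
apply: (IHn (fun s => [set u | E ((u < cell_cut s) :: s) u])) => s.
rewrite (_ : mkset _ = (`]-oo, cell_cut s[ `&` E (true :: s)) `|`
  (`[cell_cut s, +oo[ `&` E (false :: s))); last first.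
  apply/seteqP; split => u /=; rewrite !in_itv/= andbT leNgt.
    by case: (u < cell_cut s) => Eu; [left|right].
  by case: (u < cell_cut s) => -[[]|[]].
by apply: measurableU; apply: measurableI => //; exact: mE.
Qed.

Lemma measurable_digit n : measurable [set u : R | digit n u].
Proof.
rewrite /digit.
apply: (@measurable_bits n (fun s => [set u | u < cell_cut s])) => s.
by rewrite (_ : mkset _ = `]-oo, cell_cut s[%classic).
Qed.

Definition cell_itv (s : seq bool) : set R :=
  [set u | (cell s).1 <= u < (cell s).1 + (cell s).2].

Lemma cell_ge0 s : 0 <= (cell s).2.
Proof.
case/andP: p01 => p0 p1.
elim: s => [|b s]; first exact: ler01.
move=> /=; case: (cell s) => a l /= l0.
by case: b => /=; apply: mulr_ge0 => //; rewrite subr_ge0.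
Qed.

Lemma cell_itv_cons b s u :
  cell_itv (b :: s) u <-> cell_itv s u /\ (u < cell_cut s) = b.
Proof.
case/andP: p01 => p0 p1; have := cell_ge0 s.
rewrite /cell_itv /cell_cut /=; case: (cell s) => a l /= l0.
have lp : l * p <= l by rewrite ler_piMr.
have lp0 : 0 <= l * p by exact: mulr_ge0.
case: b => /=.
  split=> [/andP[au ul]|[/andP[-> _] ->//]].
  by rewrite au ul; split => //=; lra.
have -> : a + l * p + l * (1 - p) = a + l by ring.
split=> [/andP[au ul]|[/andP[au ->] /negbT]]; last by rewrite -leNgt => ->.
by rewrite ul andbT ltNge au; split => //; lra.
Qed.

Lemma bits_cell s u : cell_itv s u -> bits (size s) u = s.
Proof.
by elim: s => //= b s IHs /cell_itv_cons[su <-]; rewrite (IHs su).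
Qed.

Lemma cell_sub s : 0 <= (cell s).1 /\ (cell s).1 + (cell s).2 <= 1.
Proof.
case/andP: p01 => p0 p1.
elim: s => [|b s] /=; first by rewrite add0r.
have := cell_ge0 s; case: (cell s) => a l /= l0 [a0 al].
have lp : l * p <= l by rewrite ler_piMr.
have lp0 : 0 <= l * p by exact: mulr_ge0.
by case: b => /=; split; nra.
Qed.

Lemma measurable_cell s : measurable (cell_itv s).
Proof.
by rewrite (_ : cell_itv s = `[(cell s).1, (cell s).1 + (cell s).2[%classic).
Qed.

Let P : probability (measurableTypeR R) R := uniform_prob (@ltr01 R).

Lemma uniform_cell s : P (cell_itv s) = (cell s).2%:E.
Proof.
have [a0 al1] := cell_sub s; have l0 := cell_ge0 s.
rewrite /P /= /uniform_prob integral_uniform_pdf.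
rewrite (_ : cell_itv s `&` _ = `[(cell s).1, (cell s).1 + (cell s).2[%classic);
  last first.
  apply/seteqP; split => u; rewrite /cell_itv /= !in_itv /=; first by case.
  by move=> /andP[au ul]; rewrite au ul; split => //; lra.
rewrite (eq_integral (cst 1%E)); last first.
  move=> u; rewrite inE /= in_itv /= => /andP[au ul].
  rewrite /uniform_pdf ifT ?subr0 ?invr1//.
  by apply/andP; split; lra.
rewrite integral_cst//= mul1e.
rewrite lebesgue_measure_itv/= lte_fin ltrDl.
case: ltP => [_|l0']; first by rewrite -EFinD addrAC subrr add0r.
by congr EFin; apply/eqP; rewrite eq_le l0 l0'.
Qed.

Variables (S : pred nat) (b : nat -> bool).
Let beta (c : bool) : R := if c then p else 1 - p.

Definition cell_event (s : seq bool) (m : nat) : set R :=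
  cell_itv s `&` [set u | forall i, (size s <= i < size s + m)%N ->
    S i -> digit i u = b i].

Lemma measurable_digit_eq i c : measurable [set u : R | digit i u = c].
Proof.
case: c; first exact: measurable_digit.
rewrite (_ : mkset _ = ~` [set u | digit i u]).
  exact: measurableC (measurable_digit i).
by apply/seteqP; split => u /=; [move=> ->|move/negP/negbTE].
Qed.

Lemma measurable_cell_event s m : measurable (cell_event s m).
Proof.
apply: measurableI; first exact: measurable_cell.
rewrite (_ : mkset _ = \bigcap_(i in [set i | (size s <= i < size s + m)%N /\ S i])
  [set u | digit i u = b i]); last first.
  apply/seteqP; split => u /= H i; first by move=> [? ?]; exact: H.
  by move=> ? ?; exact: H.
by apply: bigcap_measurableType => i _; exact: measurable_digit_eq.
Qed.

Lemma cell_event_succ s m :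
  cell_event s m.+1 = \big[setU/set0]_(c <- [:: true; false] |
    S (size s) ==> (c == b (size s))) cell_event (c :: s) m.
Proof.
apply/seteqP; split => u.
- move=> [su H].
  have dE : digit (size s) u = (u < cell_cut s).
    by rewrite /digit bits_cell.
  have K : cell_event ((u < cell_cut s) :: s) m u.
    split; first by apply/cell_itv_cons.
    move=> i; rewrite /= addSnnS => /andP[si im]; apply: H.
    by rewrite (ltnW si).
  have SE : S (size s) ==> ((u < cell_cut s) == b (size s)).
    apply/implyP => Ss; rewrite -dE H// leqnn/=.
    by rewrite -addSnnS leq_addr.
  rewrite big_mkcond !big_cons big_nil /=.
  by move: K SE; case: (u < cell_cut s) => K ->; [left|right; left].
- rewrite big_mkcond !big_cons big_nil.
  have K c : S (size s) ==> (c == b (size s)) -> cell_event (c :: s) m u ->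
      cell_event s m.+1 u.
    move=> Sc [/cell_itv_cons[su uc] H]; split => // i /andP[si im] Si.
    move: si; rewrite leq_eqVlt => /predU1P[sE|si].
      rewrite /digit -sE bits_cell// uc sE; move: Sc; rewrite sE Si.
      by move/eqP.
    by apply: H => //=; rewrite si addSnnS.
  by case=> [|[|//]]; case: ifPn => // Sc /(K _ Sc).
Qed.

Lemma uniform_cell_event s m : P (cell_event s m) =
  ((cell s).2 * \prod_(size s <= i < size s + m | S i) beta (b i))%:E.
Proof.
elim: m s => [|m IHm] s.
  rewrite addn0 big_geq// mulr1 -uniform_cell; congr (P _).
  apply/seteqP; split => u; first by case.
  by move=> su; split => // i /andP[si]; rewrite addn0 ltnNge si.
have cl c : (cell (c :: s)).2 = (cell s).2 * beta c.
  by rewrite /=; case: (cell s) => a l; case: c.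
rewrite cell_event_succ big_ltn_cond; last first.
  by rewrite -addSnnS leq_addr.
rewrite big_mkcond !big_cons big_nil [X in P X]/= setU0.
have [Ss|Ss] /= := boolP (S (size s)).
  case: (b (size s)) (cl (b (size s))) => /= clE.
    by rewrite setU0 IHm /= clE addSnnS mulrA.
  by rewrite set0U IHm /= clE addSnnS mulrA.
have -> : P (cell_event (true :: s) m `|` cell_event (false :: s) m) =
    (P (cell_event (true :: s) m) + P (cell_event (false :: s) m))%E.
  apply: measureU; [exact: measurable_cell_event|exact: measurable_cell_event|].
  apply/seteqP; split => u //= -[[/cell_itv_cons[_ uc] _]].
  by move=> [/cell_itv_cons[_]]; rewrite uc.
by rewrite !IHm !cl -EFinD /= addSnnS; congr EFin; rewrite /beta; ring.
Qed.

Lemma uniform_digits N : P [set u | forall i, (i < N)%N -> S i -> digit i u = b i] =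
  (\prod_(0 <= i < N | S i) beta (b i))%:E.
Proof.
have := uniform_cell_event [::] N; rewrite /= mul1r add0n => <-.
set A := (X in P X = _).
have mA : measurable A.
  rewrite (_ : A = \bigcap_(i in [set i | (i < N)%N /\ S i])
    [set u | digit i u = b i]); last first.
    apply/seteqP; split => u /= H i; first by move=> [? ?]; exact: H.
    by move=> ? ?; exact: H.
  by apply: bigcap_measurableType => i _; exact: measurable_digit_eq.
have P1 : P (cell_itv [::]) = 1%E by rewrite uniform_cell.
have AE : cell_event [::] N = A `&` cell_itv [::].
  by rewrite setIC /cell_event; congr (_ `&` _); apply/seteqP; split => u.
rewrite AE.
have P0 : P (~` cell_itv [::]) = 0%E.
  by rewrite probability_setC ?P1 ?subee//; exact: measurable_cell.
have mC : measurable (~` cell_itv [::]).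
  by apply: measurableC; exact: measurable_cell.
have -> : P A = (P (A `&` cell_itv [::]) + P (A `&` ~` cell_itv [::]))%E.
  rewrite -[in LHS](setIT A) -(setUv (cell_itv [::])) setIUr.
  apply: measureU; last by rewrite setIACA setICr setI0.
    by apply: measurableI => //; exact: measurable_cell.
  exact: measurableI.
suff -> : P (A `&` ~` cell_itv [::]) = 0%E by rewrite adde0.
apply/eqP; rewrite eq_le measure_ge0 andbT -P0.
by apply: le_measure; rewrite ?inE//; exact: measurableI.
Qed.

End product_measure_exists.

Lemma product_measure_exists (R : realType) (V : countType)
    (nu : probability bool R) :
  exists mu : probability (config V) R,
    forall (S : seq V) (b : V -> bool), uniq S ->
      mu [set w : config V | forall x, x \in S -> w x = b x] =
      (\prod_(x <- S) nu [set b x])%E.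
Proof.
pose p := fine (nu [set true]).
have nup : nu [set true] = p%:E by rewrite fineK// fin_num_measure.
have p01 : 0 <= p <= 1.
  by rewrite -!lee_fin -nup measure_ge0; exact: probability_le1.
have nuE c : nu [set c] = (if c then p else 1 - p)%:E.
  case: c => //; rewrite (_ : [set false] = ~` [set true]).
    by rewrite probability_setC// nup.
  by apply/seteqP; split => -[] /= H; rewrite ?H//; by case: H.
pose P : probability (measurableTypeR R) R := uniform_prob (@ltr01 R).
pose X (u : measurableTypeR R) : config V := fun x => digit p (pickle x) u.
have mX : measurable_fun setT X.
  apply: (@measurability _ _ _ (config V) setT X [set A : set (V -> bool) |
    exists x : V, A = [set w | w x]]) => //.
  move=> _ [_ [x ->] <-]; rewrite setTI.
  exact: measurable_digit.
exists (distribution P (mfun_Sub (mem_set mX))) => S b uS.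
pose b' i := if unpickle i is Some x then b x else false.
have b'E x : b' (pickle x) = b x by rewrite /b' pickleK.
pose N := (\max_(x <- S) pickle x).+1.
have SN x : x \in S -> (pickle x < N)%N.
  by move=> xS; rewrite /N ltnS; exact: leq_bigmax_seq.
transitivity (P [set u | forall i, (i < N)%N -> i \in map pickle S ->
    digit p i u = b' i]).
  congr (P _); apply/seteqP; split => u /= H.
    by move=> _ _ /mapP[x xS ->]; rewrite b'E -H.
  by move=> x xS; rewrite -b'E -H ?SN ?map_f.
rewrite uniform_digits// -prodEFin -big_filter.
rewrite (perm_big (map pickle S)) ?big_map; last first.
  apply: uniq_perm; first by rewrite filter_uniq ?iota_uniq.
    by rewrite map_inj_uniq//; exact: (pcan_inj pickleK).
  move=> i; rewrite mem_filter mem_index_iota /=.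
  by case: mapP => //= -[x xS ->]; rewrite SN.
by apply: eq_bigr => x _; rewrite nuE b'E.
Qed.

(* Cylinders generate the sigma-algebra of [config V] and are closed under
   nonempty intersection, so [product_measureE] characterizes this measure. *)
Definition product_measure (R : realType) (V : countType)
    (nu : probability bool R) : probability (config V) R :=
  sval (cid (product_measure_exists V nu)).

Lemma product_measureE (R : realType) (V : countType)
    (nu : probability bool R) (S : seq V) (b : V -> bool) : uniq S ->
  product_measure V nu [set w : config V | forall x, x \in S -> w x = b x] =
  (\prod_(x <- S) nu [set b x])%E.
Proof. exact: svalP (cid (product_measure_exists V nu)) S b. Qed.

(* Unbounded operators on L^2(mu) are given by their graphs: [A f g] means
   that f is in the domain and A f = g. Elements of L^2(mu) are represented by
   square-integrable functions, up to almost everywhere equality. *)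
Section L2_operators.
Context d (T : measurableType d) (R : realType) (mu : probability T R).

Definition L2_operator := (T -> R) -> (T -> R) -> Prop.

(* Closure of the operator L with initial domain D. *)
Definition L2_closure (D : set (T -> R)) (L : (T -> R) -> T -> R) :
    L2_operator := fun f g =>
  [/\ f \in Lfun mu 2%:E, g \in Lfun mu 2%:E &
    exists h : nat -> T -> R, [/\ forall n, D (h n),
      (fun n => 'N[mu]_2%:E [EFin \o (h n \- f)%R])%E @ \oo --> 0%E &
      (fun n => 'N[mu]_2%:E [EFin \o (L (h n) \- g)%R])%E @ \oo --> 0%E]].

Definition simple_eigenvalue (A : L2_operator) (lambda : R) : Prop :=
  exists f : T -> R,
    [/\ ~ (f = cst 0 %[ae mu]),
        A f (fun t => lambda * f t) &
        forall g : T -> R, A g (fun t => lambda * g t) ->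
          exists c : R, g = (fun t => c * f t) %[ae mu]].

Definition spectral_gap (A : L2_operator) : \bar R :=
  ereal_inf [set r | exists f g : T -> R,
    [/\ A f g,
        ~ (exists c : R, f = cst c %[ae mu]) &
        r = ('E_mu[fun t => (f t * - g t)%R] / 'V_mu[f])%E]].

End L2_operators.

(* Kinetically constrained model on V in which a site x is updated only if at
   least j of the sites listed in [N x] are empty. *)
Section kinetically_constrained_model.
Context (R : realType) (V : countType) (N : V -> seq V) (j : nat).

Definition local_function (f : config V -> R) : Prop :=
  exists S : seq V, forall w w' : config V,
    (forall x, x \in S -> w x = w' x) -> f w = f w'.

Definition constraint (x : V) (w : config V) : bool :=
  (j <= \sum_(y <- N x) (1 - w y))%N.

Definition bernoulli_field (p : R) : probability (config V) R :=
  product_measure V (bernoulli_prob p).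

Definition site_average (p : R) (x : V) (f : config V -> R) (w : config V) : R :=
  \int[bernoulli_prob p]_b f [eta w with x |-> b].

(* The sum over V has finite support when f is local. *)
Definition local_generator (p : R) (f : config V -> R) (w : config V) : R :=
  \sum_(x \in [set: V]) (constraint x w)%:R * (site_average p x f w - f w).

(* Local functions form a core of the Markov generator (the degrees [size (N x)]
   being bounded), so that its self-adjoint extension is the L^2-closure. *)
Definition generator (p : R) : L2_operator (config V) R :=
  L2_closure (bernoulli_field p) local_function (local_generator p).

Definition critical_density : R :=
  sup [set p | 0 <= p < 1 /\
    simple_eigenvalue (bernoulli_field p) (generator p) 0].

Definition gap (p : R) : \bar R :=
  spectral_gap (bernoulli_field p) (generator p).

End kinetically_constrained_model.

(* The rooted k-ary tree: the word s has the children i :: s for i : 'I_k. *)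
Definition rooted_tree (k : nat) : countType := seq 'I_k.

Definition children (k : nat) (x : rooted_tree k) : seq (rooted_tree k) :=
  [seq i :: x | i <- enum 'I_k].

(* The regular tree of degree k + 1: two rooted k-ary trees, the copies
   (true, _) and (false, _), whose roots are joined by an edge. *)
Definition regular_tree (k : nat) : countType := (bool * seq 'I_k)%type.

Definition neighbors (k : nat) (x : regular_tree k) : seq (regular_tree k) :=
  let: (c, s) := x in
  (if s is _ :: s' then (c, s') else (~~ c, [::])) ::
  [seq (c, i :: s) | i <- enum 'I_k].

Lemma children_uniq k (x : rooted_tree k) : uniq (children x).
Proof. by rewrite map_inj_uniq ?enum_uniq// => i i' []. Qed.

Lemma size_children k (x : rooted_tree k) : size (children x) = k.
Proof. by rewrite size_map size_enum_ord. Qed.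

Lemma neighbors_uniq k (x : regular_tree k) : uniq (neighbors x).
Proof.
case: x => c s /=; rewrite map_inj_uniq ?enum_uniq ?andbT; last first.
  by move=> i i' [].
apply/mapP => -[i _]; case: s => [|i' s] [].
  by case: c.
by move=> sE; have := congr1 size sE; rewrite /= => /eqP; rewrite ltn_eqF.
Qed.

Lemma size_neighbors k (x : regular_tree k) : size (neighbors x) = k.+1.
Proof. by case: x => c s /=; rewrite size_map size_enum_ord. Qed.

Lemma neighbors_sym k (x y : regular_tree k) :
  (x \in neighbors y) = (y \in neighbors x).
Proof.
suff H (u v : regular_tree k) : u \in neighbors v -> v \in neighbors u.
  by apply/idP/idP; exact: H.
case: u v => [c s] [c' s']; rewrite {1}/neighbors in_cons.
case/orP => [/eqP|/mapP[i _ [-> ->]]]; last exact: mem_head.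
case: s' => [|i s'] [-> ->] /=; first by rewrite negbK mem_head.
by rewrite in_cons map_f ?orbT ?mem_enum.
Qed.

Definition FA_gap (R : realType) (k j : nat) (p : R) : \bar R :=
  gap (@neighbors k) j p.

Definition OFA_gap (R : realType) (k j : nat) (p : R) : \bar R :=
  gap (@children k) j p.

Definition FA_critical_density (R : realType) (k j : nat) : R :=
  critical_density R (@neighbors k) j.

Definition OFA_critical_density (R : realType) (k j : nat) : R :=
  critical_density R (@children k) j.

(* Main.v *)
Require Import Defs.
From mathcomp Require Import all_boot all_order all_algebra.
From mathcomp Require Import all_classical all_reals all_analysis.
From mathcomp Require Import measurable_realfun.
From mathcomp Require Import zify ring lra.

(* The constraints of the FA-jf model are weaker than those of the oriented model
   on the two rooted trees obtained by cutting one edge, so both gaps follow from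
   a Poincare inequality for oriented models.

   Let [tail l] be the probability that at least m = k + 1 - j of k independent
   events of probability l occur. The probability of surviving n steps of
   bootstrap percolation satisfies u(n+1) = p tail(u n). If p1 tail(l) > l for
   some l > 0 and p2 > p1, then at density p2 these probabilities decrease to a
   stable fixed point. The indicator of the event that the root is never emptied
   is then the L2-limit of its conditional expectations given the first n
   generations; the generator sends them to functions living on generation n,
   whose second moments decay geometrically by stability. So this indicator lies
   in the kernel of the generator and 0 is not a simple eigenvalue. Hence, below
   the critical density, p tail(l) <= r l with r < 1, and u decays exponentially.

   For the Poincare inequality, decompose the variance along the martingale
   revealing the tree from the root downwards. In the increment at x insert the
   event that x can be freed within n steps by its descendants: on this event the
   flip at x is a bounded number of legal moves below x, and the complement, of
   exponentially small probability, costs the increments at the descendants of x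
   at distance at most n + 1, which are absorbed since each vertex has at most
   n + 2 ancestors at such distances. *)

Set Implicit Arguments.
Unset Strict Implicit.
Unset Printing Implicit Defensive.

Import Order.TTheory GRing.Theory Num.Theory.
Import numFieldNormedType.Exports.

Local Open Scope classical_set_scope.
Local Open Scope ring_scope.

(** * Averages over finitely many sites *)
Definition upd (V : eqType) (w : V -> bool) (x : V) (b : bool) : V -> bool :=
  fun z => if z == x then b else w z.
Arguments upd : simpl never.

Section averages.
Context (R : realFieldType) (V : eqType) (p : R).
Implicit Types (w : V -> bool) (F G : (V -> bool) -> R) (s t : seq V).

Lemma upd_id w x : upd w x (w x) = w.
Proof. by apply/funext => z; rewrite /upd; case: eqP => [->|]. Qed.

Lemma upd_upd w x a b : upd (upd w x a) x b = upd w x b.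
Proof. by apply/funext => z; rewrite /upd; case: eqP. Qed.

Lemma updC w x y a b : x != y -> upd (upd w x a) y b = upd (upd w y b) x a.
Proof.
move=> xy; apply/funext => z; rewrite /upd.
by have [->|//] := eqVneq z y; rewrite eq_sym (negbTE xy).
Qed.

Lemma upd_eq w x b : upd w x b x = b.
Proof. by rewrite /upd eqxx. Qed.

Lemma upd_neq w x y b : y != x -> upd w x b y = w y.
Proof. by rewrite /upd => /negbTE ->. Qed.

Definition av x F w := p * F (upd w x true) + (1 - p) * F (upd w x false).

Definition avs s F := foldr av F s.

Definition grad x F w := F (upd w x true) - F (upd w x false).

Definition var s F w := avs s (fun v => F v ^+ 2) w - avs s F w ^+ 2.

Definition indep (x : V) F := forall w b, F (upd w x b) = F w.

Definition depends_on s F := forall w w', {in s, w =1 w'} -> F w = F w'.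

Lemma depends_onW s t F : {subset s <= t} -> depends_on s F -> depends_on t F.
Proof. by move=> st dF w w' ww'; apply: dF => z /st /ww'. Qed.

Lemma depends_on_indep s F x : depends_on s F -> x \notin s -> indep x F.
Proof.
move=> dF xs w b; apply: dF => z zs; rewrite upd_neq//.
by apply: contraNneq xs => <-.
Qed.

Lemma depends_on_upd x s F b :
  depends_on (x :: s) F -> depends_on s (fun w => F (upd w x b)).
Proof.
move=> dF w w' ww'; apply: dF => z; rewrite inE /upd.
by case: eqP => //= _; exact: ww'.
Qed.

Lemma avs_cat s t F : avs (s ++ t) F = avs s (avs t F).
Proof. by rewrite /avs foldr_cat. Qed.

Lemma av_id x F : indep x F -> av x F = F.
Proof. by move=> iF; apply/funext => w; rewrite /av !iF; ring. Qed.

Lemma avs_id s F : {in s, forall x, indep x F} -> avs s F = F.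
Proof.
elim: s => //= x s IHs iF; rewrite IHs; last first.
  by move=> y ys; apply: iF; rewrite inE ys orbT.
by apply: av_id; apply: iF; rewrite mem_head.
Qed.

Lemma indep_av x F : indep x (av x F).
Proof. by move=> w b; rewrite /av !upd_upd. Qed.

Lemma indep_av_neq x y F : indep x F -> indep x (av y F).
Proof.
have [->|xy] := eqVneq x y; first by move=> _; exact: indep_av.
by move=> iF w b; rewrite /av !(updC _ _ _ xy) !iF.
Qed.

Lemma indep_avs x s F : indep x F -> indep x (avs s F).
Proof. by move=> iF; elim: s => //= y s; exact: indep_av_neq. Qed.

Lemma avC x y F : av x (av y F) = av y (av x F).
Proof.
have [->//|xy] := eqVneq x y.
apply/funext => w; rewrite /av !(updC _ _ _ xy); ring.
Qed.

Lemma av_avs x s F : av x (avs s F) = avs s (av x F).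
Proof. by elim: s => //= y s <-; exact: avC. Qed.

Lemma avsC s t F : avs s (avs t F) = avs t (avs s F).
Proof. by elim: s => //= x s ->; rewrite av_avs. Qed.

Lemma avs_mem x s F : x \in s -> avs s (av x F) = avs s F.
Proof.
elim: s => //= y s IHs; rewrite inE; have [->|_ /IHs -> //] := eqVneq x y.
by move=> _; rewrite -av_avs av_id//; exact: indep_av.
Qed.

Lemma avs_absorb s t F : {subset s <= t} -> avs t (avs s F) = avs t F.
Proof.
elim: s => //= x s IHs st; rewrite avs_mem ?IHs//.
  by move=> y ys; apply: st; rewrite inE ys orbT.
by apply: st; rewrite mem_head.
Qed.

(** Averages at single sites commute and are idempotent, so only the set of sites counts. *)
Lemma eq_mem_avs s t F : s =i t -> avs s F = avs t F.
Proof.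
move=> st; rewrite -(@avs_absorb t s F); last by move=> x; rewrite st.
by rewrite avsC avs_absorb// => x; rewrite st.
Qed.

Lemma depends_on_avs s t F : depends_on (s ++ t) F -> depends_on t (avs s F).
Proof.
elim: s t => [//|x s IHs] t dF /=.
have {}dF : depends_on (x :: t) (avs s F).
  apply: IHs; apply: depends_onW dF => y.
  by rewrite /= !(mem_cat, inE); case: (y == x); case: (y \in s).
move=> w w' ww'; rewrite /av.
by rewrite (depends_on_upd true dF ww') (depends_on_upd false dF ww').
Qed.

Lemma avs_cst s F w w' : depends_on s F -> avs s F w = avs s F w'.
Proof. by move=> dF; apply: (@depends_on_avs s [::]); rewrite ?cats0. Qed.

Lemma avD x F G w : av x (fun v => F v + G v) w = av x F w + av x G w.
Proof. rewrite /av; ring. Qed.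

Lemma avM x F G w : indep x F -> av x (fun v => F v * G v) w = F w * av x G w.
Proof. by move=> iF; rewrite /av !iF; ring. Qed.

Lemma avsD s F G w : avs s (fun v => F v + G v) w = avs s F w + avs s G w.
Proof.
elim: s w => //= x s IHs w; rewrite -avD; congr (av _ _ _).
exact/funext.
Qed.

Lemma avsM s F G w : {in s, forall x, indep x F} ->
  avs s (fun v => F v * G v) w = F w * avs s G w.
Proof.
elim: s w => //= x s IHs w iF; rewrite -avM; last by apply: iF; rewrite mem_head.
congr (av _ _ _); apply/funext => v; apply: IHs => y ys.
by apply: iF; rewrite inE ys orbT.
Qed.

Lemma avsZ s (c : R) F w : avs s (fun v => c * F v) w = c * avs s F w.
Proof. exact: avsM. Qed.

Lemma avsN s F w : avs s (fun v => - F v) w = - avs s F w.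
Proof.
rewrite -mulN1r -avsZ; congr (avs _ _ _); apply/funext => v; ring.
Qed.

Lemma avsB s F G w : avs s (fun v => F v - G v) w = avs s F w - avs s G w.
Proof. by rewrite avsD avsN. Qed.

Lemma avs_const s (c : R) w : avs s (fun=> c) w = c.
Proof. by rewrite avs_id. Qed.

Lemma avs_sum (I : Type) (r : seq I) s (F : I -> (V -> bool) -> R) w :
  avs s (fun v => \sum_(i <- r) F i v) w = \sum_(i <- r) avs s (F i) w.
Proof.
elim: r => [|i r IHr].
  by under eq_fun do rewrite big_nil; rewrite big_nil avs_const.
by under eq_fun do rewrite big_cons; rewrite avsD IHr big_cons.
Qed.

(** Averaging over [s] first replaces F by its mean, a constant, because F sees only [s] and G does
    not see it. *)
Lemma avs_indepM M s F G w : {subset s <= M} -> depends_on s F ->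
  {in s, forall x, indep x G} ->
  avs M (fun v => F v * G v) w = avs M F w * avs M G w.
Proof.
move=> sM dF iG; rewrite -(avs_absorb (fun v => F v * G v) sM).
have -> : avs s (fun v => F v * G v) = fun v => avs s F w * G v.
  apply/funext => v; under eq_fun do rewrite mulrC.
  by rewrite avsM// mulrC (@avs_cst _ _ v w).
rewrite avsZ -(avs_absorb F sM).
have -> : avs s F = fun=> avs s F w by apply/funext => v; exact: avs_cst.
by rewrite avs_const.
Qed.

Lemma grad_av x y F w : x != y -> grad x (av y F) w = av y (grad x F) w.
Proof. by move=> xy; rewrite /grad /av !(updC _ _ _ xy); ring. Qed.

Lemma grad_avs x s F w : x \notin s -> grad x (avs s F) w = avs s (grad x F) w.
Proof.
elim: s w => //= y s IHs w; rewrite inE negb_or => /andP[xy xs].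
by rewrite grad_av//; congr av; apply/funext => v; exact: IHs.
Qed.

Lemma grad_indep x F w : indep x F -> grad x F w = 0.
Proof. by move=> iF; rewrite /grad !iF subrr. Qed.

Lemma indep_comp1 (h : R -> R) x F : indep x F -> indep x (fun w => h (F w)).
Proof. by move=> iF w b; rewrite iF. Qed.

(** Law of total variance with respect to the site x: the first term is the variance of a two-valued
    variable, the conditional mean given x. *)
Lemma var_cons x s F w :
  var (x :: s) F w = p * (1 - p) * grad x (avs s F) w ^+ 2 + av x (var s F) w.
Proof. rewrite /var /grad /= /av; ring. Qed.

Hypothesis p01 : 0 <= p <= 1.

Lemma avs_ge0 s F w : (forall v, 0 <= F v) -> 0 <= avs s F w.
Proof.
case/andP: p01 => p0 p1 F0; elim: s w => //= x s IHs w.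
by rewrite addr_ge0// mulr_ge0// subr_ge0.
Qed.

Lemma le_avs s F G w : (forall v, F v <= G v) -> avs s F w <= avs s G w.
Proof.
by move=> FG; rewrite -subr_ge0 -avsB avs_ge0// => v; rewrite subr_ge0.
Qed.

Lemma var_ge0 s F w : 0 <= var s F w.
Proof.
have -> : var s F w = avs s (fun v => (F v - avs s F w) ^+ 2) w.
  under eq_fun do rewrite sqrrB.
  rewrite avsD avsB avs_const /var.
  have -> : avs s (fun v => F v * avs s F w *+ 2) w =
      2 * avs s F w * avs s F w.
    by rewrite -avsZ; congr avs; apply/funext => v; rewrite -mulr_natl; ring.
  ring.
by apply: avs_ge0 => v; exact: sqr_ge0.
Qed.

Lemma avs_sqr_le s F w : avs s F w ^+ 2 <= avs s (fun v => F v ^+ 2) w.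
Proof. by rewrite -subr_ge0; exact: var_ge0. Qed.

(** Cauchy-Schwarz through a quadratic polynomial in t: the mean of [a * (t - F)^2 + (1 - a) * F^2]
    is nonnegative, and its minimum is at t = X / e. *)
Lemma avs_indicator_CS s (a : (V -> bool) -> bool) F w :
  avs s (fun v => (a v)%:R * F v) w ^+ 2 <=
  avs s (fun v => (a v)%:R) w * avs s (fun v => F v ^+ 2) w.
Proof.
set X := avs _ _ w; set e := avs _ (fun v => (a v)%:R) w; set Y := avs _ _ w.
have K (t : R) : 0 <= t ^+ 2 * e - 2 * t * X + Y.
  have -> : t ^+ 2 * e - 2 * t * X + Y =
      avs s (fun v => t ^+ 2 * (a v)%:R - 2 * t * ((a v)%:R * F v) + F v ^+ 2) w.
    by rewrite avsD avsB !avsZ.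
  apply: avs_ge0 => v; case: (a v) => /=; last by rewrite !mulr0 !mul0r !mulr0 subrr add0r sqr_ge0.
  rewrite (_ : _ + _ = (t - F v) ^+ 2) ?sqr_ge0//; ring.
have e0 : 0 <= e by apply: avs_ge0 => v; exact: ler0n.
have Y0 : 0 <= Y by apply: avs_ge0 => v; exact: sqr_ge0.
(* If the event is null the polynomial is affine in t; unless X = 0, the chosen t gives it the value
   -1. *)
have [ez|en] := eqVneq e 0.
  rewrite ez mul0r; have [->|Xn] := eqVneq X 0; first by rewrite expr0n.
  have := K ((Y + 1) / (2 * X)); rewrite ez mulr0 sub0r.
  have -> : 2 * ((Y + 1) / (2 * X)) * X = Y + 1 by field.
  lra.
have {}e0 : 0 < e by rewrite lt_def en.
have := K (X / e).
rewrite (_ : _ + Y = (e * Y - X ^+ 2) / e); last by field.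
by rewrite pmulr_lge0 ?invr_gt0// subr_ge0.
Qed.

End averages.

(** * Rooted forests and the level-by-level martingale *)

Section tree.
Context (V : eqType) (ch : V -> seq V) (dp : V -> nat).
Hypothesis ch_uniq : forall x, uniq (ch x).
Hypothesis dp_ch : forall x y, y \in ch x -> dp y = (dp x).+1.
Hypothesis ch_inj : forall x x' y, y \in ch x -> y \in ch x' -> x = x'.

Fixpoint subtree (n : nat) (x : V) : seq V :=
  x :: (if n is n'.+1 then flatten [seq subtree n' y | y <- ch x] else [::]).

(** Reaches distance n + 1 from x, one generation further than [subtree n x]. *)
Definition below (n : nat) (x : V) : seq V :=
  flatten [seq subtree n y | y <- ch x].

Lemma subtreeS n x : subtree n.+1 x = x :: below n x.
Proof. by []. Qed.

Lemma mem_subtree n x : x \in subtree n x.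
Proof. by case: n => [|n]; exact: mem_head. Qed.

Lemma dp_subtree n x y : y \in subtree n x -> (dp x <= dp y)%N.
Proof.
elim: n x y => [|n IHn] x y /=; first by rewrite inE => /eqP ->.
rewrite inE => /predU1P[->//|/flatten_mapP[z zx /IHn]].
by rewrite (dp_ch zx); exact: ltnW.
Qed.

Lemma dp_below n x y : y \in below n x -> (dp x < dp y)%N.
Proof. by move=> /flatten_mapP[z zx /dp_subtree]; rewrite (dp_ch zx). Qed.

Lemma notin_below n x : x \notin below n x.
Proof. by apply/negP => /dp_below; rewrite ltnn. Qed.


Lemma subtree_le n n' x : (n <= n')%N -> {subset subtree n x <= subtree n' x}.
Proof.
elim: n n' x => [|n IHn] n' x.
  by move=> _ y; rewrite inE => /eqP ->; exact: mem_subtree.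
case: n' => // n' nn' y; rewrite !subtreeS !inE => /predU1P[->|].
  by rewrite eqxx.
move=> /flatten_mapP[z zx yz]; apply/orP; right; apply/flatten_mapP.
by exists z => //; exact: IHn yz.
Qed.

Lemma subtree_last n x y : y \in subtree n x ->
  y = x \/ exists2 z, z \in subtree n x & y \in ch z.
Proof.
elim: n x y => [|n IHn] x y; first by rewrite inE => /eqP ->; left.
rewrite inE => /predU1P[->|]; first by left.
move=> /flatten_mapP[z zx /IHn[->|[u uz yu]]]; right.
  by exists x => //; exact: mem_subtree.
exists u => //; rewrite subtreeS inE; apply/orP; right.
by apply/flatten_mapP; exists z.
Qed.

(** Induction on the depth of y: its parent, unique by [ch_inj], lies in both subtrees until a root
    is reached, and equal depths force both roots to be reached at once. *)
Lemma subtree_root n x x' y :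
  y \in subtree n x -> y \in subtree n x' -> dp x = dp x' -> x = x'.
Proof.
have [d] := ubnP (dp y); elim: d y => // d IHd y yd yx yx' xx'.
case: (subtree_last yx) => [yE|[u ux yu]].
  case: (subtree_last yx') => [<-//|[u ux' yu]].
  have := dp_subtree ux'; have := dp_ch yu.
  by rewrite yE xx' => ->; rewrite ltnn.
case: (subtree_last yx') => [yE|[u' ux' yu']].
  have := dp_subtree ux; have := dp_ch yu.
  by rewrite yE -xx' => ->; rewrite ltnn.
rewrite -(ch_inj yu yu') in ux'; apply: IHd ux ux' xx'.
by rewrite -ltnS -(dp_ch yu).
Qed.

(** What the inductions over a list of children use; unlike being of the form [ch x], it survives
    removing the head of the list. *)
Definition siblings (s : seq V) :=
  uniq s /\ {in s &, forall y z, dp y = dp z}.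

Lemma siblings_ch x : siblings (ch x).
Proof. by split => // y z yx zx; rewrite (dp_ch yx) (dp_ch zx). Qed.

Lemma siblings_cons x s : siblings (x :: s) ->
  siblings s /\ forall n, {in subtree n x, forall z,
    z \notin flatten [seq subtree n y | y <- s]}.
Proof.
move=> [/= /andP[xs us] dps]; split; first split => //.
  by move=> y z ys zs; apply: dps; rewrite inE ?ys ?zs orbT.
move=> n z zx; apply/negP => /flatten_mapP[y ys zy].
have yx : y = x.
  by apply: (subtree_root zy zx); apply: dps; rewrite inE ?ys ?eqxx ?orbT.
by move: xs; rewrite -yx ys.
Qed.

Lemma uniq_flatten_ch s : uniq s -> uniq (flatten [seq ch x | x <- s]).
Proof.
elim: s => //= x s IHs /andP[xs us].
rewrite cat_uniq ch_uniq IHs// andbT; apply/hasPn => y.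
move=> /flatten_mapP[z zs yz]; apply/negP => /= yx.
by move: xs; rewrite (ch_inj yx yz) zs.
Qed.

Lemma uniq_flatten_subtree n s : (forall x, uniq (subtree n x)) -> siblings s ->
  uniq (flatten [seq subtree n y | y <- s]).
Proof.
move=> un; elim: s => //= y s IHs sys; have [ss dis] := siblings_cons sys.
rewrite cat_uniq un IHs// andbT.
by apply/hasPn => z zs; apply/negP => /= /dis; rewrite zs.
Qed.

Lemma uniq_subtree n x : uniq (subtree n x).
Proof.
elim: n x => [//|n IHn] x; rewrite subtreeS /= notin_below /=.
exact/uniq_flatten_subtree/siblings_ch.
Qed.

(* Each vertex has at most one ancestor at each distance. *)
Lemma sum_subtree_le (R : realDomainType) (phi : V -> R) (tot : R) (n : nat) s :
    uniq s -> (forall t, uniq t -> \sum_(x <- t) phi x <= tot) ->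
  \sum_(x <- s) \sum_(y <- subtree n x) phi y <= n.+1%:R * tot.
Proof.
move=> + phit; elim: n s => [|n IHn] s us.
  rewrite mul1r; under eq_bigr do rewrite big_seq1; exact: phit.
under eq_bigr do rewrite subtreeS big_cons.
rewrite big_split -natr1 mulrDl mul1r addrC lerD ?phit//=.
have -> : \sum_(x <- s) \sum_(y <- below n x) phi y =
    \sum_(x <- flatten [seq ch x | x <- s]) \sum_(y <- subtree n x) phi y.
  rewrite big_flatten big_map; apply: eq_bigr => x _.
  by rewrite /below big_flatten big_map.
exact/IHn/uniq_flatten_ch.
Qed.

Section poincare.
Context (R : realFieldType) (p : R).
Hypothesis p01 : 0 <= p <= 1.
Implicit Types (w : V -> bool) (f : (V -> bool) -> R).

Lemma eq_mem_var s t f w : s =i t -> var p s f w = var p t f w.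
Proof. by move=> st; rewrite /var !(eq_mem_avs _ _ st). Qed.

Definition deeper (L : seq V) (x : V) := [seq z <- L | (dp x < dp z)%N].

(* When the sites of L are revealed level by level from the top, the increment of
   the martingale of f at x has variance at most p(1-p) times [levelgrad]. *)
Definition levelgrad (L : seq V) f w (x : V) : R :=
  avs p L (fun v => grad x (avs p (deeper L x) f) v ^+ 2) w.

Lemma levelgrad_ge0 L f w x : 0 <= levelgrad L f w x.
Proof. by apply: avs_ge0 => // v; exact: sqr_ge0. Qed.

Let dple : rel V := fun x y => (dp x <= dp y)%N.

(** The sites of W are already averaged out. Peel off the shallowest site y of [s] with [var_cons]:
    the gradient at y is taken after averaging over the rest, which contains every site deeper than
    y, and Jensen's inequality moves the excess average out of the square. *)
Lemma var_le_levelgrad_sorted L s W f w :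
    sorted dple s -> uniq s -> {subset s <= L} -> {subset W <= L} ->
    {in s, forall y, y \notin W} ->
    {in s & L, forall y z, (dp y < dp z)%N -> z \in s ++ W} ->
  avs p L (var p s (avs p W f)) w <=
  p * (1 - p) * \sum_(y <- s) levelgrad L f w y.
Proof.
elim: s => [|y s IHs].
  rewrite big_nil mulr0 => *; rewrite /var /=.
  by under eq_fun do rewrite subrr; rewrite avs_const.
move=> sys /= /andP[ys us] sL WL sW clos.
have dys : all (dple y) s.
  by apply: order_path_min sys => a b c; exact: leq_trans.
have yL : y \in L by apply: sL; rewrite mem_head.
rewrite (funext (var_cons p y s (avs p W f))) avsD avsZ avs_mem// big_cons.
rewrite (mulrDr (p * (1 - p))) lerD//; last first.
  apply: IHs => //; first exact: path_sorted sys.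
  - by move=> z zs; apply: sL; rewrite inE zs orbT.
  - by move=> z zs; apply: sW; rewrite inE zs orbT.
  move=> z u zs uL zu; have := clos z u; rewrite inE zs orbT => /(_ isT uL zu).
  rewrite /= inE => /predU1P[uy|//].
  by move: zu; rewrite uy ltnNge; have /= := allP dys _ zs; rewrite /dple => ->.
apply: ler_wpM2l; first by case/andP: p01 => ? ?; rewrite mulr_ge0// subr_ge0.
have dsub : {subset deeper L y <= s ++ W}.
  move=> z; rewrite mem_filter => /andP[yz zL].
  have := clos y z; rewrite mem_head => /(_ isT zL yz).
  by rewrite /= inE => /predU1P[zy|//]; move: yz; rewrite zy ltnn.
rewrite -avs_cat -(avs_absorb _ f dsub).
have ysW : y \notin s ++ W by rewrite mem_cat (negbTE ys) sW// mem_head.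
have sWL : {subset s ++ W <= L}.
  by move=> z; rewrite mem_cat => /orP[zs|/WL//]; apply: sL; rewrite inE zs orbT.
rewrite /levelgrad -(avs_absorb _ (fun v => grad y (avs p (deeper L y) f) v ^+ 2) sWL).
apply: le_avs => // v; rewrite (grad_avs _ _ _ ysW); exact: avs_sqr_le.
Qed.

Lemma var_le_levelgrad L s W f w :
    uniq s -> {subset s <= L} -> {subset W <= L} ->
    {in s, forall y, y \notin W} ->
    {in s & L, forall y z, (dp y < dp z)%N -> z \in s ++ W} ->
  avs p L (var p s (avs p W f)) w <=
  p * (1 - p) * \sum_(y <- s) levelgrad L f w y.
Proof.
move=> us sL WL sW clos; have ss := mem_sort dple s.
have -> : var p s (avs p W f) = var p (sort dple s) (avs p W f).
  by apply/funext => v; apply: eq_mem_var => z; rewrite ss.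
rewrite -(perm_big _ (permEl (perm_sort dple s))).
apply: var_le_levelgrad_sorted => //.
- by apply: sort_sorted => a b; exact: leq_total.
- by rewrite sort_uniq.
- by move=> z; rewrite ss => /sL.
- by move=> z; rewrite ss => /sW.
by move=> y z; rewrite ss mem_cat ss -mem_cat => *; exact: (clos y).
Qed.

End poincare.
End tree.

(** * Bootstrap percolation and legal moves *)

Section bootstrap.
Context (V : eqType) (ch : V -> seq V) (dp : V -> nat) (j k : nat).
Hypothesis ch_uniq : forall x, uniq (ch x).
Hypothesis dp_ch : forall x y, y \in ch x -> dp y = (dp x).+1.
Hypothesis ch_inj : forall x x' y, y \in ch x -> y \in ch x' -> x = x'.
Hypothesis size_ch : forall x, size (ch x) = k.
Local Notation subtree := (subtree ch).
Local Notation below := (below ch).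
Implicit Types (w : V -> bool) (x y : V).

Fixpoint emptied (n : nat) (x : V) (w : V -> bool) : bool :=
  ~~ w x ||
  (if n is n'.+1 then (j <= count (fun y => emptied n' y w) (ch x))%N
   else false).

(** The state of x itself is ignored. For n = 0 this is the constraint of the oriented model; in
    general it looks n + 1 generations down. *)
Definition removable (n : nat) (x : V) (w : V -> bool) : bool :=
  (j <= count (fun y => emptied n y w) (ch x))%N.
Arguments removable : simpl never.

Lemma emptiedS n x w : emptied n.+1 x w = ~~ w x || removable n x w.
Proof. by []. Qed.

Lemma eq_emptied n x w w' :
  {in subtree n x, w =1 w'} -> emptied n x w = emptied n x w'.
Proof.
elim: n x => [|n IHn] x ww' /=; first by rewrite ww' ?mem_head.
rewrite ww' ?mem_head//; congr (_ || (_ <= _)%N).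
apply: eq_in_count => y yx; apply: IHn => z zy; apply: ww'.
by rewrite subtreeS inE; apply/orP; right; apply/flatten_mapP; exists y.
Qed.

Lemma eq_removable n x w w' :
  {in below n x, w =1 w'} -> removable n x w = removable n x w'.
Proof.
move=> ww'; congr (_ <= _)%N; apply: eq_in_count => y yx.
by apply: eq_emptied => z zy; apply: ww'; apply/flatten_mapP; exists y.
Qed.

Lemma removable_upd n x y w b : y \notin below n x ->
  removable n x (upd w y b) = removable n x w.
Proof.
move=> yx; apply: eq_removable => z zx; rewrite upd_neq//.
by apply: contraNneq yx => <-.
Qed.

(* The children in s2 may still be emptied in n steps, those in s1 have to be
   empty already. Emptying them one at a time turns [removable n.+1] into
   [removable 0]. *)
Let mix n (s1 s2 : seq V) w :=
  (j <= count (fun y => emptied 0 y w) s1 + count (fun y => emptied n y w) s2)%N.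

(** Siblings have disjoint subtrees, so emptying y does not affect the status of the other children,
    while y itself now counts for certain. *)
Let mix_upd n y s1 s2 w :
  siblings dp (y :: s2) -> y \notin s1 ->
  mix n s1 (y :: s2) w -> mix n (y :: s1) s2 (upd w y false).
Proof.
move=> sys ys1; rewrite /mix /= upd_eq /= -addnA.
have [ss dis] := siblings_cons dp_ch ch_inj sys.
rewrite (_ : count (emptied 0 ^~ (upd w y false)) s1 =
  count (fun z => emptied 0 z w) s1); last first.
  apply: eq_in_count => z zs; rewrite /= upd_neq//.
  by apply: contraNneq ys1 => <-.
rewrite (_ : count (emptied n ^~ (upd w y false)) s2 =
  count (fun z => emptied n z w) s2); last first.
  apply: eq_in_count => z zs; apply: eq_emptied => u uz; rewrite upd_neq//.
  have yn := mem_subtree ch n y; apply: contraNneq (dis n y yn) => uy.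
  by apply/flatten_mapP; exists z; rewrite -?uy.
by case: (emptied n y w) => /=; lia.
Qed.

(** * Comparison of delayed flips with legal flips *)

Section comparison.
Context (R : realFieldType) (p : R).
Hypothesis p01 : 0 < p < 1.

Let p01W : 0 <= p <= 1.
Proof. by case/andP: p01 => p0 p1; rewrite !ltW. Qed.

(** The 1 is for configurations where y need not be emptied. Otherwise 2 comes from the square of a
    sum and 1 / (1 - p) from the change of measure when y is emptied. *)
Definition move_cost : R := 1 + 2 / (1 - p).
(** The 4 comes from the squares of sums, the other factor from bounding the values at both states
    of x by their average over x. *)
Definition flip_cost : R := 4 * (p^-1 + (1 - p)^-1).

Definition energy (L : seq V) (n : nat) (f : (V -> bool) -> R) w x : R :=
  avs p L (fun v => (removable n x v)%:R * grad x f v ^+ 2) w.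

Lemma energy_ge0 L n f w x : 0 <= energy L n f w x.
Proof. by apply: avs_ge0 => // v; rewrite mulr_ge0// sqr_ge0. Qed.

(** Change of measure: emptying y amounts to conditioning on an event of probability 1 - p. *)
Let avs_upd_le L y (F : (V -> bool) -> R) w : y \in L -> (forall v, 0 <= F v) ->
  avs p L (fun v => F (upd v y false)) w <= (1 - p)^-1 * avs p L F w.
Proof.
case/andP: p01 => p0 p1 yL F0; rewrite -(avs_mem _ F yL) -avsZ.
apply: le_avs => // v; rewrite /av mulrDr mulKf ?gt_eqF ?subr_gt0//.
by rewrite lerDr mulr_ge0// ?invr_ge0 ?mulr_ge0 ?subr_ge0// ltW.
Qed.

(** The flip at x is replaced by the path that empties y, flips x and refills y. The gradient at x
    is thus the gradient at x with y empty plus the difference of the gradients at y for the two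
    states of x. *)
Let mix_step L n x y s1 s2 f w :
    siblings dp (y :: s2) -> y \notin s1 -> y \in ch x ->
    x \in L -> y \in L ->
  avs p L (fun v => (mix n.+1 s1 (y :: s2) v)%:R * grad x f v ^+ 2) w <=
  move_cost * avs p L (fun v => (mix n.+1 (y :: s1) s2 v)%:R * grad x f v ^+ 2) w
  + flip_cost * energy L n f w y.
Proof.
case/andP: p01 => p0 p1 sys ys1 yx xL yL.
pose Phi v := (mix n.+1 (y :: s1) s2 v)%:R * grad x f v ^+ 2.
pose G v := (removable n y v)%:R * grad y f v ^+ 2.
have q0 : 0 < 1 - p by rewrite subr_gt0.
have xy : x != y by apply: contraTneq yx => <-; apply/negP => /dp_ch; lia.
have xbelow : x \notin below n y.
  by apply/negP => /(dp_below dp_ch); rewrite (dp_ch yx) ltnNge leqnSn.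
have pt v : (mix n.+1 s1 (y :: s2) v)%:R * grad x f v ^+ 2 <=
    (Phi v + 2 * Phi (upd v y false)) +
    4 * (p^-1 + (1 - p)^-1) * av p x G v.
  have Phi0 u : 0 <= Phi u by rewrite mulr_ge0// sqr_ge0.
  have G0 u : 0 <= G u by rewrite mulr_ge0// sqr_ge0.
  (* Both states of x occur along the path, each at the price of its inverse probability. *)
  have avG : G (upd v x true) + G (upd v x false) <=
      (p^-1 + (1 - p)^-1) * av p x G v.
    rewrite /av; move: (G0 (upd v x true)) (G0 (upd v x false)).
    set a := G _; set b := G (upd v x false) => a0 b0.
    rewrite -subr_ge0 (_ : _ - _ = (1 - p)^-1 * p * a + p^-1 * (1 - p) * b).
      have [? ?] : 0 <= p^-1 /\ 0 <= (1 - p)^-1 by rewrite !invr_ge0 !ltW.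
      by apply: addr_ge0; do 2!apply: mulr_ge0 => //; exact: ltW.
    by field; rewrite !gt_eqF.
  rewrite -(mulrA 4); move: avG (Phi0 v) (Phi0 (upd v y false)).
  move: (G0 (upd v x true)) (G0 (upd v x false)); set Y := (_ * av _ _ _ _).
  have [mv|_] := boolP (mix n.+1 s1 (y :: s2) v); last first.
    by rewrite mul0r; lra.
  have [mv'|mv'] := boolP (mix n.+1 (y :: s1) s2 v).
    have -> : Phi v = grad x f v ^+ 2 by rewrite /Phi mv' mul1r.
    by rewrite mul1r; lra.
  (* The path is used only when y is occupied and removable; otherwise moving y to the first list
     does not lower the count. *)
  have vy : v y.
    apply: contraNT mv' => vy; move: mv.
    by rewrite /mix /= vy /= -!addnA (addnCA 1%N).
  have rv : removable n y v.
    apply: contraNT mv' => /negbTE rv; move: mv.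
    by rewrite /mix /= -/(removable n y v) vy rv.
  have -> : Phi (upd v y false) = grad x f (upd v y false) ^+ 2.
    by rewrite /Phi mix_upd// mul1r.
  have Gb b : G (upd v x b) = grad y f (upd v x b) ^+ 2.
    by rewrite /G removable_upd// rv mul1r.
  have vE b : upd v x b = upd (upd v x b) y true.
    by rewrite -[in LHS](upd_id v y) vy (updC _ _ _ xy).
  have fE b : grad y f (upd v x b) = f (upd v x b) - f (upd (upd v y false) x b).
    by rewrite {2}vE -(updC _ _ _ xy).
  rewrite !Gb !fE /grad mul1r.
  move: (f (upd v x true)) (f (upd v x false)) (f (upd (upd v y false) x true))
    (f (upd (upd v y false) x false)) (Phi v) => a b c d ph.
  (* These squares encode [(u + v)^2 <= 2 * u^2 + 2 * v^2], used once to split off c - d and once to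
     split the difference of a - c and b - d. *)
  have := sqr_ge0 (a - b - 2 * (c - d)).
  have := sqr_ge0 ((a - c) + (b - d)).
  nra.
apply: (le_trans (le_avs p01W L w pt)).
rewrite avsD avsD avsZ avsZ avs_mem// -/(energy L n f w y).
have := @avs_upd_le L y Phi w yL; rewrite -/Phi /move_cost /flip_cost.
set A := avs p L Phi w => /(_ _)/wrap[u|]; first by rewrite mulr_ge0// sqr_ge0.
have -> : (1 + 2 / (1 - p)) * A = A + 2 * ((1 - p)^-1 * A) by ring.
lra.
Qed.

(** Empty the k children one after the other. Each application of [mix_step] costs a factor
    [move_cost] and one flip at a child that is removable within n; at the end only empty children
    are counted. *)
Lemma energy_removable_step L n x f w : {subset x :: ch x <= L} ->
  energy L n.+1 f w x <=
  move_cost ^+ k * (energy L 0 f w x +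
                    flip_cost * \sum_(y <- ch x) energy L n f w y).
Proof.
move=> sL.
have mc1 : 1 <= move_cost.
  by case/andP: p01 => p0 p1; rewrite lerDl divr_ge0// subr_ge0 ltW.
have fc0 : 0 <= flip_cost.
  case/andP: p01 => p0 p1.
  by rewrite mulr_ge0// addr_ge0// invr_ge0 ?subr_ge0 ltW.
have H s1 s2 : siblings dp s2 -> {in s2, forall y, y \notin s1} ->
    {subset s2 <= ch x} ->
    avs p L (fun v => (mix n.+1 s1 s2 v)%:R * grad x f v ^+ 2) w <=
    move_cost ^+ (size s2) *
      (avs p L (fun v => (mix n.+1 (catrev s2 s1) [::] v)%:R * grad x f v ^+ 2) w
       + flip_cost * \sum_(y <- s2) energy L n f w y).
  elim: s2 s1 => [|y s2 IHs] s1 sib dis sub.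
    by rewrite big_nil mulr0 addr0 mul1r.
  have yx : y \in ch x by apply: sub; rewrite mem_head.
  apply: le_trans (mix_step _ _ _ sib _ yx _ _) _.
  - by apply: dis; rewrite mem_head.
  - by apply: sL; rewrite mem_head.
  - by apply: sL; rewrite inE yx orbT.
  have [sib2 _] := siblings_cons dp_ch ch_inj sib.
  have dis2 : {in s2, forall z, z \notin y :: s1}.
    move=> z zs; rewrite inE negb_or dis ?inE ?zs ?orbT// andbT.
    by case: sib => /= /andP[ys _] _; apply: contraNneq ys => <-.
  have sub2 : {subset s2 <= ch x}.
    by move=> z zs; apply: sub; rewrite inE zs orbT.
  have := IHs (y :: s1) sib2 dis2 sub2.
  rewrite big_cons exprS; set A := avs _ _ _ _; set B := avs _ _ _ _.
  set S := \sum_(_ <- _) _ => AB.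
  have e0 : 0 <= energy L n f w y by exact: energy_ge0.
  have mck : 1 <= move_cost ^+ size s2 by exact: exprn_ege1.
  have fe0 : 0 <= flip_cost * energy L n f w y by exact: mulr_ge0.
  have h1 := ler_wpM2l (le_trans ler01 mc1) AB.
  have h2 : flip_cost * energy L n f w y <=
      move_cost * move_cost ^+ size s2 * (flip_cost * energy L n f w y).
    by rewrite ler_peMl// mulr_ege1.
  by apply: le_trans (lerD h1 h2) _; rewrite le_eqVlt; apply/orP; left; apply/eqP; ring.
have sib := siblings_ch ch_uniq dp_ch x.
have := H [::] (ch x) sib (fun _ _ => isT) (fun _ yx => yx).
rewrite size_ch => /le_trans; apply.
rewrite le_eqVlt; apply/orP; left; apply/eqP; congr (_ * (_ + _)).
congr (avs _ _ _ _); apply/funext => v; congr (_%:R * _).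
by rewrite /mix /removable -/(rev _) count_rev addn0.
Qed.

(** Iterating the one-generation comparison down the tree gives a constant that depends on n but not
    on the vertex, the function or the volume. *)
Lemma energy_removable_le n : exists C : R, 0 <= C /\ forall L f w x,
  {subset subtree n x <= L} ->
  energy L n f w x <= C * \sum_(y <- subtree n x) energy L 0 f w y.
Proof.
have mc0 : 0 <= move_cost.
  by case/andP: p01 => p0 p1; rewrite addr_ge0// divr_ge0// subr_ge0 ltW.
have fc0 : 0 <= flip_cost.
  case/andP: p01 => p0 p1.
  by rewrite mulr_ge0// addr_ge0// invr_ge0 ?subr_ge0 ltW.
elim: n => [|n [C [C0 IHn]]].
  by exists 1; split => // L f w x _; rewrite mul1r big_seq1.
exists (move_cost ^+ k * (1 + flip_cost * C)); split.
  by rewrite mulr_ge0 ?exprn_ge0// addr_ge0// mulr_ge0.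
move=> L f w x sL; apply: le_trans (energy_removable_step _ _ _ _) _.
  move=> y; rewrite inE => /predU1P[->|yx]; apply: sL.
    exact: mem_subtree.
  rewrite subtreeS inE; apply/orP; right; apply/flatten_mapP; exists y => //.
  exact: mem_subtree.
rewrite -mulrA ler_wpM2l ?exprn_ge0// subtreeS big_cons.
set e := energy L 0 f w x; set S := \sum_(_ <- below _ _) _.
have e0 : 0 <= e by exact: energy_ge0.
have S0 : 0 <= S by apply: sumr_ge0 => y _; exact: energy_ge0.
have : \sum_(y <- ch x) energy L n f w y <= C * S.
  rewrite /S /below big_flatten big_map mulr_sumr.
  rewrite big_seq [leRHS]big_seq; apply: ler_sum => y yx; apply: IHn.
  move=> z zy; apply: sL; rewrite subtreeS inE; apply/orP; right.
  by apply/flatten_mapP; exists y.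
move=> /(ler_wpM2l fc0) => H.
have : 0 <= flip_cost * C * e by do 2!apply: mulr_ge0 => //.
move: H S0; move: S (\sum_(y <- ch x) _) flip_cost => S X c H S0 ce.
lra.
Qed.

End comparison.
End bootstrap.
Arguments removable : simpl never.

(** * Poincare inequality for local functions *)

Section variance_bounds.
Context (R : realFieldType) (V : eqType) (p : R).
Hypothesis p01 : 0 <= p <= 1.
Implicit Types (w : V -> bool) (F G : (V -> bool) -> R).

Lemma avs_upd s F x b w : x \notin s ->
  avs p s (fun v => F (upd v x b)) w = avs p s F (upd w x b).
Proof.
elim: s w => //= y s IHs w; rewrite inE negb_or => /andP[xy xs].
by rewrite /av !IHs// !(updC _ _ _ xy).
Qed.

Lemma indep_avs_mem s F x : x \in s -> indep x (avs p s F).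
Proof. by move=> xs; rewrite -(avs_mem _ _ xs) -av_avs; exact: indep_av. Qed.

Lemma avs_var s F : avs p s (var p s F) = var p s F.
Proof.
by apply: avs_id => x xs w b; rewrite /var !(indep_avs_mem _ xs).
Qed.

(** Parallelogram identity, with the variance of the sum dropped. *)
Lemma var_subD_le s F G w :
  var p s (fun v => F v - G v) w <= 2 * var p s F w + 2 * var p s G w.
Proof.
have := var_ge0 p01 s (fun v => F v + G v) w; rewrite /var.
have sD : avs p s (fun v => (F v + G v) ^+ 2) w = avs p s (fun v => F v ^+ 2) w
    + 2 * avs p s (fun v => F v * G v) w + avs p s (fun v => G v ^+ 2) w.
  by rewrite -avsZ -!avsD; congr avs; apply/funext => v; ring.
have sB : avs p s (fun v => (F v - G v) ^+ 2) w = avs p s (fun v => F v ^+ 2) w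
    - 2 * avs p s (fun v => F v * G v) w + avs p s (fun v => G v ^+ 2) w.
  by rewrite -avsZ -avsB -!avsD; congr avs; apply/funext => v; ring.
rewrite sD sB avsD avsB; nra.
Qed.

(** The gradient is the difference of F with x occupied and F with x empty; p (1 - p) is at most
    each of the weights p and 1 - p of these two cases in [av]. *)
Lemma var_grad_le s F x w : x \notin s ->
  p * (1 - p) * var p s (grad x F) w <= 2 * av p x (var p s F) w.
Proof.
case/andP: p01 => p0 p1 xs.
have varE b : var p s (fun v => F (upd v x b)) w = var p s F (upd w x b).
  by rewrite /var !(avs_upd _ _ _ xs) (avs_upd (fun v => F v ^+ 2)).
have := var_subD_le s (fun v => F (upd v x true)) (fun v => F (upd v x false)) w.
rewrite -/(grad x F) !varE /av.
have := var_ge0 p01 s F (upd w x true); have := var_ge0 p01 s F (upd w x false).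
move: (var p s F (upd w x true)) (var p s F (upd w x false)) (var p s (grad x F) w).
move=> A B C A0 B0 H.
have pq0 : 0 <= p * (1 - p) by rewrite mulr_ge0// subr_ge0.
have := ler_wpM2l pq0 H.
have : 0 <= p * p * A by rewrite !mulr_ge0.
have : 0 <= (1 - p) * (1 - p) * B by do 2!apply: mulr_ge0 => //; rewrite subr_ge0.
lra.
Qed.

(* The mean of F over the complement of [a] is, up to a factor absorbed on the
   left, a covariance, bounded by Cauchy-Schwarz. *)
Lemma sqr_avs_split s (a : (V -> bool) -> bool) F (e : R) w :
    e <= 2^-1 -> avs p s (fun v => (~~ a v)%:R) w <= e ->
  avs p s F w ^+ 2 <=
  8 * avs p s (fun v => (a v)%:R * F v ^+ 2) w + 8 * e * var p s F w.
Proof.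
move=> e2; set d := avs _ _ _ _ => de; set m := avs p s F w.
have d0 : 0 <= d by apply: avs_ge0 => // v; exact: ler0n.
have h1 : avs p s (fun v => (a v)%:R * F v) w ^+ 2 <=
    avs p s (fun v => (a v)%:R * F v ^+ 2) w.
  apply: le_trans (avs_sqr_le p01 _ _ _) _; apply: le_avs => // v.
  by case: (a v); rewrite ?mul1r// mul0r expr0n mul0r.
have h2 := avs_indicator_CS p01 s (fun v => ~~ a v) (fun v => F v - m) w.
have vE : avs p s (fun v => (F v - m) ^+ 2) w = var p s F w.
  rewrite /var -/m (_ : (fun v => _) = fun v => F v ^+ 2 - (2 * m) * F v + m ^+ 2).
    by rewrite avsD avsB avsZ avs_const -/m; ring.
  by apply/funext => v; ring.
have h3 : (1 - d) * m = avs p s (fun v => (a v)%:R * F v) w +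
    avs p s (fun v => (~~ a v)%:R * (F v - m)) w.
  have mE : m = avs p s (fun v => (a v)%:R * F v) w +
      avs p s (fun v => (~~ a v)%:R * F v) w.
    rewrite -avsD /m; congr avs; apply/funext => v.
    by case: (a v) => /=; ring.
  have -> : avs p s (fun v => (~~ a v)%:R * (F v - m)) w =
      avs p s (fun v => (~~ a v)%:R * F v) w - m * d.
    by rewrite /d -avsZ -avsB; congr avs; apply/funext => v; ring.
  rewrite mulrBl mul1r {1}mE; ring.
rewrite vE -/d in h2; have v0 := var_ge0 p01 s F w.
move: h1 h2 h3 v0; set A := avs p s (fun v => (a v)%:R * F v) w.
set A2 := avs _ _ _ _; set B := avs _ _ _ _; move: (var p s F w) => Y.
move=> h1 h2 h3 Y0.
have h4 : ((1 - d) * m) ^+ 2 <= 2 * A2 + 2 * (d * Y).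
  rewrite h3; have := sqr_ge0 (A - B); lra.
have h5 : d * Y <= e * Y by exact: ler_wpM2r.
(* Here e at most 1/2 enters: it gives 1 - d at least 1/2. *)
have h6 : 4^-1 * m ^+ 2 <= ((1 - d) * m) ^+ 2.
  rewrite exprMn ler_wpM2r ?sqr_ge0//.
    by have := sqr_ge0 (1 - d - 2^-1); lra.
lra.
Qed.

End variance_bounds.

Section poincare_local.
Context (V : eqType) (ch : V -> seq V) (dp : V -> nat) (j k : nat).
Hypothesis ch_uniq : forall x, uniq (ch x).
Hypothesis dp_ch : forall x y, y \in ch x -> dp y = (dp x).+1.
Hypothesis ch_inj : forall x x' y, y \in ch x -> y \in ch x' -> x = x'.
Hypothesis size_ch : forall x, size (ch x) = k.
Context (R : realFieldType) (p : R).
Hypothesis p01 : 0 < p < 1.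
Local Notation subtree := (subtree ch).
Local Notation below := (below ch).
Implicit Types (w : V -> bool) (x y : V) (f : (V -> bool) -> R).

Let p01W : 0 <= p <= 1.
Proof. by case/andP: p01 => p0 p1; rewrite !ltW. Qed.

(** The split of [sqr_avs_split] along removability of x. On the event, Jensen's inequality bounds
    the term by the energy at x; off the event, the variance over the sites below x remains and is
    expanded again along levels, with the small factor e. *)
Lemma levelgrad_le_energy n L x f w (e : R) :
    uniq L -> {subset x :: below n x <= L} -> e <= 2^-1 ->
    (forall v, avs p (below n x) (fun u => (~~ removable ch j n x u)%:R) v <= e) ->
  levelgrad dp p L f w x <=
  8 * energy ch j p L n f w x +
  16 * e * \sum_(y <- below n x) levelgrad dp p L f w y.
Proof.
move=> uL sL e2 he; case/andP: (p01) => p0 p1.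
have e0 : 0 <= e.
  by apply: le_trans (he w); apply: avs_ge0 => // v; exact: ler0n.
have xL : x \in L by apply: sL; rewrite mem_head.
have KL : {subset below n x <= L} by move=> y yK; apply: sL; rewrite inE yK orbT.
set K := below n x in he KL *.
(* The deeper sites that do not influence removability of x; they are averaged out first. *)
pose W := [seq z <- deeper dp L x | z \notin K].
have WL : {subset W <= L} by move=> z; rewrite !mem_filter => /and3P[].
have KW y : y \in K -> y \notin W by rewrite mem_filter => ->.
have xK : x \notin K by exact: (notin_below dp_ch).
have xW : x \notin W by rewrite !mem_filter ltnn andbF.
have DE : deeper dp L x =i K ++ W.
  move=> z; rewrite mem_cat [in RHS]mem_filter.
  have [zK|//] := boolP (z \in K).
  by rewrite mem_filter KL// (dp_below dp_ch zK).
have uK : uniq K.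
  apply: (uniq_flatten_subtree dp_ch ch_inj).
    by move=> y; exact: (uniq_subtree ch_uniq dp_ch ch_inj).
  exact: siblings_ch.
set g := grad x (avs p W f).
have lgE : levelgrad dp p L f w x = avs p L (fun v => avs p K g v ^+ 2) w.
  rewrite /levelgrad (eq_mem_avs _ _ DE); congr avs; apply/funext => v.
  by rewrite avs_cat grad_avs.
have {lgE} -> : levelgrad dp p L f w x = avs p L (fun v => avs p K g v ^+ 2) w.
  exact: lgE.
pose a := removable ch j n x.
apply: (@le_trans _ _ (avs p L (fun v =>
    8 * avs p K (fun u => (a u)%:R * g u ^+ 2) v + 8 * e * var p K g v) w)).
  by apply: le_avs => // v; exact: sqr_avs_split.
rewrite avsD avsZ avsZ avs_absorb//; apply: lerD.
  rewrite ler_pM2l// /energy -(avs_absorb _ (fun v => (a v)%:R * grad x f v ^+ 2) WL).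
  apply: le_avs => // v; rewrite avsM; last first.
    move=> z zW u b; rewrite /a removable_upd//.
    by apply: contraTN zW; exact: KW.
  by rewrite ler_wpM2l// /g grad_avs//; exact: avs_sqr_le.
(* The factor 2 pays for replacing the variance of the gradient at x by the variance of the
   function; p (1 - p) cancels against the one in [var_le_levelgrad]. *)
have -> : 16 * e = 8 * e * 2 by ring.
rewrite -[leRHS]mulrA ler_wpM2l//; first exact: mulr_ge0.
have pq0 : 0 < p * (1 - p) by rewrite mulr_gt0// subr_gt0.
rewrite -(ler_pM2l pq0) -avsZ.
apply: (@le_trans _ _ (avs p L (fun v => 2 * av p x (var p K (avs p W f)) v) w)).
  by apply: le_avs => // v; exact: var_grad_le.
rewrite avsZ avs_mem// mulrCA ler_pM2l//.
apply: var_le_levelgrad => // y z yK zL yz.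
rewrite -DE mem_filter zL andbT; apply: leq_ltn_trans yz.
by apply: ltnW; exact: dp_below yK.
Qed.

Lemma sum_support_le (phi : V -> R) (S t : seq V) : (forall x, 0 <= phi x) ->
    (forall x, x \notin S -> phi x = 0) -> uniq S -> uniq t ->
  \sum_(x <- t) phi x <= \sum_(x <- S) phi x.
Proof.
move=> phi0 phiS uS ut.
rewrite (bigID [in S]) /= [X in _ + X]big1 ?addr0; last by move=> x; exact: phiS.
rewrite [leRHS](bigID [in t]) /= (_ : \sum_(i <- t | _) _ = \sum_(i <- S | i \in t) phi i).
  by rewrite lerDl sumr_ge0.
rewrite -big_filter -[RHS]big_filter; apply: perm_big.
apply: uniq_perm; rewrite ?filter_uniq// => x.
by rewrite !mem_filter andbC.
Qed.

(** Sum [levelgrad_le_energy] over S. The volume L has to contain the subtrees in which the legal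
    moves take place. *)
Lemma poincare_local n (e : R) : 0 <= e -> 16 * e * n.+2%:R <= 2^-1 ->
    (forall x v, avs p (below n x) (fun u => (~~ removable ch j n x u)%:R) v <= e) ->
  exists C : R, 0 <= C /\ forall S L f w, depends_on S f -> uniq S -> uniq L ->
    {subset S <= L} -> {in S, forall x, {subset subtree n.+1 x <= L}} ->
    var p L f w <= C * \sum_(x <- S) energy ch j p L 0 f w x.
Proof.
move=> e0 en he; have [C [C0 HC]] := energy_removable_le j ch_uniq dp_ch ch_inj size_ch p01 n.
case/andP: (p01) => p0 p1; have pq0 : 0 < p * (1 - p) by rewrite mulr_gt0// subr_gt0.
exists (p * (1 - p) * (16 * (C * n.+1%:R))); split.
  by rewrite mulr_ge0 ?(ltW pq0)// mulr_ge0// mulr_ge0.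
move=> S L f w dS uS uL SL subL.
pose T := levelgrad dp p L f w.
have T_ge0 x : 0 <= T x by exact: levelgrad_ge0.
have TS x : x \notin S -> T x = 0.
  move=> xS; rewrite /T /levelgrad.
  rewrite (_ : (fun v => _) = fun=> 0) ?avs_const//; apply/funext => v.
  by rewrite grad_indep ?expr0n//; apply/indep_avs/(depends_on_indep dS).
have totT t : uniq t -> \sum_(x <- t) T x <= \sum_(x <- S) T x.
  by move=> ut; exact: sum_support_le.
have varT : var p L f w <= p * (1 - p) * \sum_(x <- S) T x.
  apply: (@le_trans _ _ (p * (1 - p) * \sum_(x <- L) T x)); last first.
    by rewrite ler_pM2l// totT.
  rewrite -avs_var; apply: (@var_le_levelgrad _ _ _ _ p01W L L [::] f) => //.
  by move=> y z _ zL _; rewrite cats0.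
have e2 : e <= 2^-1.
  have : (1 : R) <= n.+2%:R by rewrite ler1n.
  nra.
(* A vertex has at most n + 2 ancestors at distance at most n + 1, itself included, so by [en] the
   error is at most half of the left-hand side; absorbing it doubles the 8. *)
have TE : \sum_(x <- S) T x <= 16 * \sum_(x <- S) energy ch j p L n f w x.
  have H1 : \sum_(x <- S) T x <= 8 * \sum_(x <- S) energy ch j p L n f w x +
      16 * e * \sum_(x <- S) \sum_(y <- subtree n.+1 x) T y.
    rewrite !mulr_sumr -big_split /= big_seq [leRHS]big_seq.
    apply: ler_sum => x xS; apply: le_trans (levelgrad_le_energy f w uL _ e2 (he x)) _.
      by move=> y; rewrite -subtreeS => /(subL x xS).
    rewrite lerD2l ler_wpM2l//; first exact: mulr_ge0.
    by rewrite big_cons lerDr.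
  have H2 := sum_subtree_le ch_uniq ch_inj n.+1 uS totT.
  have := ler_wpM2l (mulr_ge0 (ler0n R 16) e0) H2.
  have ST0 : 0 <= \sum_(x <- S) T x by exact: sumr_ge0.
  have := ler_wpM2r ST0 en.
  move: H1; set A := \sum_(_ <- _) T _; set B := \sum_(_ <- _) energy _ _ _ _ _ _ _ _.
  set D := \sum_(_ <- _) \sum_(_ <- _) _.
  lra.
apply: le_trans varT _; rewrite -!mulrA ler_pM2l// ler_pM2l ?subr_gt0//.
apply: le_trans TE _; rewrite ler_pM2l//.
(* Delayed flips become legal flips in subtrees of height n, where each vertex is counted at most n
   + 1 times. *)
apply: (@le_trans _ _ (C * \sum_(x <- S) \sum_(y <- subtree n x)
    energy ch j p L 0 f w y)).
  rewrite mulr_sumr big_seq [leRHS]big_seq; apply: ler_sum => x xS.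
  by apply: HC => y yx; apply: (subL x xS); exact: subtree_le yx.
rewrite ler_wpM2l//; apply: (sum_subtree_le ch_uniq ch_inj n uS) => t ut.
apply: sum_support_le => // [x|x xS]; first exact: energy_ge0.
rewrite /energy (_ : (fun v => _) = fun=> 0) ?avs_const//; apply/funext => v.
by rewrite grad_indep ?expr0n ?mulr0//; exact: (depends_on_indep dS).
Qed.

End poincare_local.

(** * Survival probabilities *)

Section threshold.
Context (R : realFieldType).
Implicit Types (m : nat) (s : seq R).

(* Probability that at least m of independent events with probabilities s occur,
   and its derivative at s in a direction. *)
Fixpoint atleast (m : nat) (s : seq R) : R :=
  if m is m'.+1 then
    if s is t :: s' then t * atleast m' s' + (1 - t) * atleast m'.+1 s' else 0
  else 1.

Fixpoint datleast (m : nat) (s : seq (R * R)) : R :=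
  if m is m'.+1 then
    if s is (t, a) :: s' then
      a * (atleast m' (unzip1 s') - atleast m'.+1 (unzip1 s')) +
      (t * datleast m' s' + (1 - t) * datleast m'.+1 s')
    else 0
  else 0.

Lemma atleast0 s : atleast 0 s = 1.
Proof. by case: s. Qed.

Lemma datleast0 (s : seq (R * R)) : datleast 0 s = 0.
Proof. by case: s. Qed.

Lemma atleast_bool m (I : Type) (b : I -> bool) (r : seq I) :
  atleast m [seq (b i)%:R | i <- r] = (m <= count b r)%:R.
Proof.
elim: r m => [|i r IHr] [|m] //=; rewrite !IHr.
by case: (b i) => /=; rewrite ?add1n ?add0n ?ltnS; ring.
Qed.

Lemma atleast_eq0 m s : (count (fun t : R => t != 0%R) s < m)%N -> atleast m s = 0.
Proof.
elim: s m => [|t s IHs] [|m] //=; have [->|tn] := eqVneq t 0 => /= H.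
  by rewrite mul0r add0r IHs// mulr0.
by rewrite !IHs ?mulr0 ?addr0//; lia.
Qed.

Definition unit_seq s := all (fun t => 0 <= t <= 1) s.

Lemma atleast_bounds m s : unit_seq s ->
  [/\ 0 <= atleast m s, atleast m s <= 1 & atleast m.+1 s <= atleast m s].
Proof.
elim: s m => [|t s IHs] m.
  by case: m => [|m] _; split=> //=; exact: ler01.
move=> /= /andP[/andP[t0 t1] us]; case: m => [|m].
  have [h1 h2 h3] := IHs 0%N us; rewrite atleast0 in h1 h2 h3 *; split => //=; nra.
have [h1 h2 h3] := IHs m us; have [h4 h5 h6] := IHs m.+1 us; split; nra.
Qed.

Lemma le_atleast (I : eqType) (f g : I -> R) m (r : seq I) :
    {in r, forall i, 0 <= f i <= g i} -> {in r, forall i, g i <= 1} ->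
  atleast m [seq f i | i <- r] <= atleast m [seq g i | i <- r].
Proof.
elim: r m => [|i r IHr] [|m] //= fg g1; rewrite ?lexx//.
have /andP[f0 fgi] := fg i (mem_head _ _); have gi1 := g1 i (mem_head _ _).
have fg' : {in r, forall i, 0 <= f i <= g i}.
  by move=> x xr; apply: fg; rewrite inE xr orbT.
have g1' : {in r, forall i, g i <= 1}.
  by move=> x xr; apply: g1; rewrite inE xr orbT.
have h1 := IHr m fg' g1'; have h2 := IHr m.+1 fg' g1'.
have us : unit_seq [seq g i | i <- r].
  apply/allP => _ /mapP[x xr ->]; rewrite g1'// andbT.
  by have /andP[/le_trans] := fg' x xr; apply.
have [h3 h4 h5] := atleast_bounds m us.
set A := atleast m _ in h1 *; set B := atleast m.+1 _ in h2 *.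
set C := atleast m _ in h1 h3 h4 h5 *; set D := atleast m.+1 _ in h2 h5 *.
have : 0 <= (g i - f i) * (C - D) by rewrite mulr_ge0 ?subr_ge0.
have : f i * A <= f i * C by exact: ler_wpM2l.
have : (1 - f i) * B <= (1 - f i) * D by apply: ler_wpM2l => //; rewrite subr_ge0; lra.
lra.
Qed.

Definition tail m k (l : R) := atleast m (nseq k l).

Definition dtail m k (l : R) := datleast m (nseq k (l, 1)).

Lemma unzip1_nseq k (l : R) : unzip1 (nseq k (l, 1 : R)) = nseq k l.
Proof. by elim: k => //= k ->. Qed.

Lemma tailS m k l :
  tail m.+1 k.+1 l = l * tail m k l + (1 - l) * tail m.+1 k l.
Proof. by []. Qed.

Lemma dtailS m k l : dtail m.+1 k.+1 l =
  (tail m k l - tail m.+1 k l) + (l * dtail m k l + (1 - l) * dtail m.+1 k l).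
Proof. by rewrite /dtail /= unzip1_nseq mul1r. Qed.

Lemma unit_nseq k (l : R) : 0 <= l <= 1 -> unit_seq (nseq k l).
Proof. by move=> l01; rewrite /unit_seq all_nseq l01 orbT. Qed.

Lemma tail_bounds m k l : 0 <= l <= 1 ->
  [/\ 0 <= tail m k l, tail m k l <= 1 & tail m.+1 k l <= tail m k l].
Proof. by move=> l01; apply: atleast_bounds; exact: unit_nseq. Qed.

Lemma le_tail m k l l' : 0 <= l -> l <= l' -> l' <= 1 ->
  tail m k l <= tail m k l'.
Proof.
move=> l0 ll' l1; rewrite /tail -(map_nseq k (fun=> l) tt) -(map_nseq k (fun=> l') tt).
by apply: le_atleast => i _ //; rewrite l0.
Qed.

(** Each of the k coordinates contributes a partial derivative between 0 and 1. *)
Lemma dtail_bounds m k l : 0 <= l <= 1 -> 0 <= dtail m k l <= k%:R.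
Proof.
move=> l01; case/andP: (l01) => l0 l1; elim: k m => [|k IHk] [|m].
- by rewrite /dtail /= lexx.
- by rewrite /dtail /= lexx.
- by rewrite /dtail /= lexx ler0n.
rewrite dtailS; have [h1 h2 h3] := tail_bounds m k l01.
have [h4 h5 h6] := tail_bounds m.+1 k l01.
have /andP[h7 h8] := IHk m; have /andP[h9 h10] := IHk m.+1.
have -> : (k.+1%:R : R) = 1 + (l * k%:R + (1 - l) * k%:R) by rewrite -natr1; ring.
have q0 : 0 <= 1 - l by rewrite subr_ge0.
have := mulr_ge0 l0 h7; have := mulr_ge0 q0 h9.
have := ler_wpM2l l0 h8; have := ler_wpM2l q0 h10.
by move=> *; apply/andP; split; lra.
Qed.

End threshold.

(** * Conditional survival probabilities and the action of the generator on them *)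

Section survival.
Context (V : eqType) (ch : V -> seq V) (dp : V -> nat) (j m k : nat).
Hypothesis ch_uniq : forall x, uniq (ch x).
Hypothesis dp_ch : forall x y, y \in ch x -> dp y = (dp x).+1.
Hypothesis ch_inj : forall x x' y, y \in ch x -> y \in ch x' -> x = x'.
Hypothesis size_ch : forall x, size (ch x) = k.
Hypothesis jmk : (j + m)%N = k.+1.
Context (R : realFieldType) (p : R).
Hypothesis p01 : 0 <= p <= 1.
Local Notation subtree := (subtree ch).
Local Notation below := (below ch).
Local Notation siblings := (siblings dp).
Implicit Types (w : V -> bool) (x y : V) (a : R) (s M : seq V).

(* Conditional probability that x is never emptied given the first n
   generations below x, when a vertex of generation n is never emptied with
   probability a if it is occupied. *)
Fixpoint psi a (n : nat) (x : V) (w : V -> bool) : R :=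
  (w x)%:R *
  (if n is n'.+1 then atleast m [seq psi a n' y w | y <- ch x] else a).

Definition psis a n s w := atleast m [seq psi a n y w | y <- s].

(* The generator applied to [psi a n x]: only the generation n contributes, since
   a vertex with at least j empty children has no influence above it. *)
Fixpoint psi_drift a (n : nat) (x : V) (w : V -> bool) : R :=
  if n is n'.+1 then
    (w x)%:R * datleast m [seq (psi a n' y w, psi_drift a n' y w) | y <- ch x]
  else (removable ch j 0 x w)%:R * (a * (p - (w x)%:R)).

Fixpoint survival a (n : nat) : R :=
  p * (if n is n'.+1 then tail m k (survival a n') else a).

Lemma psi_bounds a n x w : 0 <= a <= 1 -> 0 <= psi a n x w <= 1.
Proof.
move=> a01; case/andP: (a01) => a0 a1.
elim: n x => [|n IHn] x /=; case: (w x); rewrite ?mul1r ?mul0r ?lexx ?ler01//.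
have [|h1 h2 _] := @atleast_bounds _ m [seq psi a n y w | y <- ch x].
  by apply/allP => _ /mapP[y _ ->].
by rewrite h1.
Qed.

Lemma unit_psi a n s w : 0 <= a <= 1 -> unit_seq [seq psi a n y w | y <- s].
Proof. by move=> a01; apply/allP => _ /mapP[y _ ->]; exact: psi_bounds. Qed.

Lemma survival_bounds a n : 0 <= a <= 1 -> 0 <= survival a n <= 1.
Proof.
move=> a01; case/andP: p01 => p0 p1; case/andP: (a01) => a0 a1.
elim: n => [|n IHn] /=; first by rewrite mulr_ge0// mulr_ile1.
have [h1 h2 _] := tail_bounds m k IHn.
by rewrite mulr_ge0// mulr_ile1.
Qed.

Lemma le_psi a n x w : 0 <= a <= 1 -> psi a n x w <= psi 1 n x w.
Proof.
move=> a01; elim: n x => [|n IHn] x /=; apply: ler_wpM2l => //.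
  by case/andP: a01.
apply: le_atleast => y yx.
  by rewrite IHn; case/andP: (psi_bounds n y w a01) => ->.
by case/andP: (@psi_bounds 1 n y w (introT andP (conj ler01 (lexx _)))).
Qed.

Lemma count_emptied n x w :
  (m <= count (fun y => ~~ emptied ch j n y w) (ch x))%N = ~~ removable ch j n x w.
Proof.
have := count_predC (fun y => emptied ch j n y w) (ch x).
rewrite size_ch /removable.
rewrite (_ : count (predC _) _ = count (fun y => ~~ emptied ch j n y w) (ch x))//.
set c := count _ _; set d := count _ _; lia.
Qed.

Lemma psi1E n x w : psi 1 n x w = (~~ emptied ch j n x w)%:R.
Proof.
elim: n x => [|n IHn] x /=; first by rewrite mulr1 orbF negbK.
rewrite (eq_map (g := fun y => (~~ emptied ch j n y w)%:R)) => [|y]; last exact: IHn.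
by rewrite atleast_bool count_emptied negb_or negbK -natrM mulnb.
Qed.

Lemma psis1E n x w : psis 1 n (ch x) w = (~~ removable ch j n x w)%:R.
Proof.
rewrite /psis (eq_map (g := fun y => (~~ emptied ch j n y w)%:R)) => [|y]; last exact: psi1E.
by rewrite atleast_bool count_emptied.
Qed.

Lemma eq_psi a n x w w' : {in subtree n x, w =1 w'} -> psi a n x w = psi a n x w'.
Proof.
elim: n x => [|n IHn] x ww' /=; rewrite ww' ?mem_head//; congr (_ * atleast _ _).
apply/eq_in_map => y yx; apply: IHn => z zy; apply: ww'.
by rewrite subtreeS inE; apply/orP; right; apply/flatten_mapP; exists y.
Qed.

Lemma eq_psi_drift a n x w w' : {in subtree n.+1 x, w =1 w'} ->
  psi_drift a n x w = psi_drift a n x w'.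
Proof.
elim: n x => [|n IHn] x ww'; rewrite /= ww' ?mem_head//.
  congr ((nat_of_bool _)%:R * _); apply: eq_removable => y yx; apply: ww'.
  by rewrite subtreeS inE yx orbT.
congr (_ * datleast _ _); apply/eq_in_map => y yx.
have H : {in subtree n.+1 y, w =1 w'}.
  move=> z zy; apply: ww'; rewrite subtreeS inE; apply/orP; right.
  by apply/flatten_mapP; exists y.
by rewrite IHn// (@eq_psi _ _ _ w w')// => z zy; apply: H; exact: subtree_le zy.
Qed.

Lemma indep_psi a n x z : z \notin subtree n x -> indep z (psi a n x).
Proof.
by move=> zx; apply: (depends_on_indep _ zx) => w w'; exact: eq_psi.
Qed.

Lemma indep_psi_drift a n x z : z \notin subtree n.+1 x -> indep z (psi_drift a n x).
Proof.
by move=> zx; apply: (depends_on_indep _ zx) => w w'; exact: eq_psi_drift.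
Qed.

Lemma indep_map_psi n a s z (G : seq R -> R) :
  z \notin flatten [seq subtree n y | y <- s] ->
  indep z (fun w => G [seq psi a n y w | y <- s]).
Proof.
move=> zs w b; congr G; apply/eq_in_map => y ys; apply: indep_psi.
by apply: contra zs => zy; apply/flatten_mapP; exists y.
Qed.

Lemma indep_map_drift n a s z (G : seq (R * R) -> R) :
  z \notin flatten [seq subtree n.+1 y | y <- s] ->
  indep z (fun w => G [seq (psi a n y w, psi_drift a n y w) | y <- s]).
Proof.
move=> zs w b; congr G; apply/eq_in_map => y ys.
have zy : z \notin subtree n.+1 y.
  by apply: contra zs => zy; apply/flatten_mapP; exists y.
rewrite indep_psi_drift// indep_psi//.
by apply: contra zy; exact: subtree_le.
Qed.

(** Independence of one child's subtree from those of its siblings. *)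
Lemma avs_siblingsM n y s M F G w : siblings (y :: s) ->
    {subset subtree n y <= M} -> depends_on (subtree n y) F ->
    (forall z, z \notin flatten [seq subtree n u | u <- s] -> indep z G) ->
  avs p M (fun v => F v * G v) w = avs p M F w * avs p M G w.
Proof.
move=> sib yM dF iG; apply: (avs_indepM _ _ yM dF) => z zy; apply: iG.
by have [_ dis] := siblings_cons dp_ch ch_inj sib; exact: dis.
Qed.

Lemma avs_occupied M x G w : x \in M -> indep x G ->
  avs p M (fun v => (v x)%:R * G v) w = p * avs p M G w.
Proof.
move=> xM iG; rewrite (@avs_indepM _ _ p M [:: x]).
- congr (_ * _); rewrite -(avs_mem _ _ xM).
  rewrite (_ : av _ _ _ = fun=> p) ?avs_const//.
  by apply/funext => v; rewrite /av !upd_eq /=; ring.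
- by move=> y; rewrite inE => /eqP ->.
- by move=> v v' vv'; rewrite vv'// mem_head.
by move=> y; rewrite inE => /eqP ->.
Qed.

Lemma subset_flatten_cons n y s M :
  {subset flatten [seq subtree n z | z <- y :: s] <= M} ->
  {subset subtree n y <= M} /\ {subset flatten [seq subtree n z | z <- s] <= M}.
Proof. by move=> sM; split=> z zs; apply: sM; rewrite /= mem_cat zs ?orbT. Qed.

(** [atleast] is affine in each argument and the children are independent, so each argument may be
    replaced by its mean. *)
Lemma avs_atleast_psi a n (l : R) q s M w : siblings s ->
    {subset flatten [seq subtree n y | y <- s] <= M} ->
    {in s, forall y, avs p M (psi a n y) w = l} ->
  avs p M (fun v => atleast q [seq psi a n y v | y <- s]) w = tail q (size s) l.
Proof.
elim: s q => [|y s IHs] q sib sM Hl; first by rewrite avs_const.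
have [yM sM'] := subset_flatten_cons sM.
have [sib' _] := siblings_cons dp_ch ch_inj sib.
have Hl' : {in s, forall z, avs p M (psi a n z) w = l}.
  by move=> z zs; apply: Hl; rewrite inE zs orbT.
case: q => [|q]; first by rewrite avs_const.
pose X q v := atleast q [seq psi a n z v | z <- s].
rewrite (_ : (fun v => _) = fun v => psi a n y v * X q v +
    (X q.+1 v - psi a n y v * X q.+1 v)); last first.
  by apply/funext => v /=; rewrite -/(X q v) -/(X q.+1 v); ring.
have dpsi : depends_on (subtree n y) (psi a n y) by move=> v v'; exact: eq_psi.
rewrite avsD avsB !(avs_siblingsM _ sib yM dpsi); last 2 first.
- by move=> z zs; exact: indep_map_psi.
- by move=> z zs; exact: indep_map_psi.
rewrite !IHs// Hl ?mem_head//= /tail /=; ring.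
Qed.

Lemma avs_psi a n x M w : {subset subtree n x <= M} ->
  avs p M (psi a n x) w = survival a n.
Proof.
elim: n x => [|n IHn] x xM.
  rewrite (@avs_occupied M x (fun=> a)) ?avs_const//.
  by apply: xM; exact: mem_head.
have bM : {subset below n x <= M} by move=> y yb; apply: xM; rewrite subtreeS inE yb orbT.
rewrite (@avs_occupied M x (psis a n (ch x))).
- rewrite (@avs_atleast_psi a n (survival a n)) ?size_ch//.
    exact: siblings_ch.
  move=> y yx; apply: IHn => z zy; apply: bM.
  by apply/flatten_mapP; exists y.
- by apply: xM; exact: mem_head.
by apply: indep_map_psi; exact: (notin_below dp_ch).
Qed.

Lemma avs_removable n x w :
  avs p (below n x) (fun v => (~~ removable ch j n x v)%:R) w =
  tail m k (survival 1 n).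
Proof.
under eq_fun do rewrite -psis1E.
rewrite (@avs_atleast_psi 1 n (survival 1 n)) ?size_ch//.
  exact: siblings_ch.
move=> y yx; apply: avs_psi => z zy.
by apply/flatten_mapP; exists y.
Qed.

Definition finite_generator s (F : (V -> bool) -> R) w : R :=
  \sum_(x <- s) (removable ch j 0 x w)%:R * (av p x F w - F w).

(** A flip changes a single argument of [atleast], which is affine in it; hence the generator obeys
    the chain rule without remainder, and [datleast] is that derivative. *)
Lemma finite_generator_psis a n q s w : siblings s ->
    {in s, forall y, finite_generator (subtree n y) (psi a n y) w =
                     psi_drift a n y w} ->
  finite_generator (flatten [seq subtree n y | y <- s])
    (fun v => atleast q [seq psi a n y v | y <- s]) w =
  datleast q [seq (psi a n y w, psi_drift a n y w) | y <- s].
Proof.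
elim: s q => [|y s IHs] [|q] sib Hy.
- by rewrite /finite_generator big_nil.
- by rewrite /finite_generator big_nil.
- rewrite /finite_generator big1// => z _.
  by rewrite /av; ring.
have [sib' dis] := siblings_cons dp_ch ch_inj sib.
have Hy' : {in s, forall y, finite_generator (subtree n y) (psi a n y) w =
    psi_drift a n y w} by move=> z zs; apply: Hy; rewrite inE zs orbT.
pose X q v := atleast q [seq psi a n z v | z <- s].
have unzE : unzip1 [seq (psi a n z w, psi_drift a n z w) | z <- s] =
    [seq psi a n z w | z <- s] by rewrite /unzip1 -map_comp.
transitivity (finite_generator (subtree n y ++ flatten [seq subtree n z | z <- s])
  (fun v => psi a n y v * X q v + (1 - psi a n y v) * X q.+1 v) w); first by [].
rewrite /finite_generator big_cat /= unzE -/(X q w) -/(X q.+1 w); congr (_ + _).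
  rewrite -[psi_drift a n y w]Hy ?mem_head// /finite_generator mulr_suml.
  rewrite big_seq [RHS]big_seq; apply: eq_bigr => z zy.
  have iX q' : indep z (X q') by apply: indep_map_psi; exact: dis.
  by rewrite /av !iX; ring.
rewrite -!IHs// /finite_generator !mulr_sumr -big_split /=.
rewrite big_seq [RHS]big_seq; apply: eq_bigr => z zs.
have ipsi : indep z (psi a n y).
  by apply: indep_psi; apply/negP => zy; move: (dis n z zy); rewrite zs.
by rewrite /av !ipsi /X; ring.
Qed.

Lemma finite_generator_psi a n x w :
  finite_generator (subtree n x) (psi a n x) w = psi_drift a n x w.
Proof.
elim: n x => [|n IHn] x.
  by rewrite /finite_generator big_seq1 /= /av !upd_eq /=; ring.
rewrite /finite_generator subtreeS big_cons.
have xb := notin_below dp_ch n x.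
have ips : indep x (psis a n (ch x)) by exact: indep_map_psi.
rewrite [X in X + _](_ : _ = 0) ?add0r; last first.
  have [rx|_] := boolP (removable ch j 0 x w); last by rewrite mul0r.
  (* With j empty children at most k - j = m - 1 children can survive, so [psi] vanishes whatever
     the state of x and the root term drops out. *)
  have p0 : psis a n (ch x) w = 0.
    apply: atleast_eq0; rewrite count_map.
    move: rx; rewrite /removable /=.
    have := count_predC (fun y => ~~ w y || false) (ch x); rewrite size_ch.
    have : (count (fun y => psi a n y w != 0%R) (ch x) <=
        count (predC (fun y => ~~ w y || false)) (ch x))%N.
      apply: sub_count => y /=; rewrite orbF negbK.
      by apply: contraNT => /negbTE wy; case: (n) => [|n'] /=; rewrite wy mul0r.
    rewrite /preim /=; set c := count _ _; set d := count _ _; set e := count _ _; lia.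
  have E b : psi a n.+1 x (upd w x b) = 0.
    by rewrite /= -/(psis a n (ch x) _) ips p0 mulr0.
  have E0 : psi a n.+1 x w = 0 by rewrite -(E (w x)) upd_id.
  by rewrite /av !E E0 !mulr0 addr0 subrr mulr0.
rewrite /= -finite_generator_psis; last 2 first.
- exact: siblings_ch.
- by move=> y _; exact: IHn.
rewrite /finite_generator mulr_sumr big_seq [RHS]big_seq; apply: eq_bigr => z zb.
have zx : x != z by apply: contraNneq xb => xz; rewrite {1}xz.
by rewrite /av !upd_neq//; ring.
Qed.

End survival.

(** * Moments of the drift when the survival sequence is constant *)

Section drift_moments.
Context (V : eqType) (ch : V -> seq V) (dp : V -> nat) (j m k : nat).
Hypothesis ch_uniq : forall x, uniq (ch x).
Hypothesis dp_ch : forall x y, y \in ch x -> dp y = (dp x).+1.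
Hypothesis ch_inj : forall x x' y, y \in ch x -> y \in ch x' -> x = x'.
Hypothesis size_ch : forall x, size (ch x) = k.
Context (R : realFieldType) (p a l : R).
Hypothesis p01 : 0 <= p <= 1.
Hypothesis a01 : 0 <= a <= 1.
Hypothesis survivalE : forall n, survival m k p a n = l.
Local Notation subtree := (subtree ch).
Local Notation below := (below ch).
Local Notation siblings := (siblings dp).
Local Notation psi := (psi ch m a).
Local Notation drift := (psi_drift ch j m p a).
Implicit Types (w : V -> bool) (x y : V) (s M : seq V).

Let l01 : 0 <= l <= 1.
Proof. by rewrite -(survivalE 0); exact: survival_bounds. Qed.

Let X n s q w := atleast q [seq psi n y w | y <- s].
Let D n s q w := datleast q [seq (psi n y w, drift n y w) | y <- s].

Let D_cons n y s q w : D n (y :: s) q.+1 w =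
  drift n y w * (X n s q w - X n s q.+1 w) +
  (psi n y w * D n s q w + (1 - psi n y w) * D n s q.+1 w).
Proof. by rewrite /D /= /unzip1 -map_comp. Qed.

Let X_diff n s q w : 0 <= X n s q w - X n s q.+1 w <= 1.
Proof.
have us := unit_psi ch m n s w a01.
have [h1 h2 h3] := atleast_bounds q us; have [h4 h5 h6] := atleast_bounds q.+1 us.
by rewrite /X; apply/andP; split; lra.
Qed.

Let indep_X n s q z : z \notin flatten [seq subtree n.+1 y | y <- s] ->
  indep z (X n s q).
Proof.
move=> zs; apply: indep_map_psi; apply: contra zs.
move=> /flatten_mapP[y ys zy]; apply/flatten_mapP; exists y => //.
exact: subtree_le zy.
Qed.

Let indep_D n s q z : z \notin flatten [seq subtree n.+1 y | y <- s] ->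
  indep z (D n s q).
Proof. exact: indep_map_drift. Qed.

Let dep_psi n y : depends_on (subtree n.+1 y) (psi n y).
Proof.
move=> w w' ww'; apply: eq_psi => z zy; apply: ww'; exact: subtree_le zy.
Qed.

Let dep_drift n y : depends_on (subtree n.+1 y) (drift n y).
Proof. by move=> w w'; exact: eq_psi_drift. Qed.

Let avs_X n s q M w : siblings s ->
    {subset flatten [seq subtree n.+1 y | y <- s] <= M} ->
  avs p M (X n s q) w = tail q (size s) l.
Proof.
move=> sib sM.
have sub : {subset flatten [seq subtree n y | y <- s] <= M}.
  move=> z /flatten_mapP[y ys zy]; apply: sM; apply/flatten_mapP.
  by exists y => //; exact: subtree_le zy.
apply: (avs_atleast_psi dp_ch ch_inj) => // y ys.
rewrite -(survivalE n); apply: (avs_psi m ch_uniq dp_ch ch_inj size_ch) => z zy.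
by apply: sub; apply/flatten_mapP; exists y.
Qed.

Let avs_psi_l n s y M w : {subset flatten [seq subtree n.+1 y | y <- s] <= M} ->
  y \in s -> avs p M (psi n y) w = l.
Proof.
move=> sM ys; rewrite -(survivalE n).
apply: (avs_psi m ch_uniq dp_ch ch_inj size_ch) => z zy.
by apply: sM; apply/flatten_mapP; exists y => //; exact: subtree_le zy.
Qed.

(** The triangle inequality along [D_cons] and independence of the head reproduce the recursion
    [dtailS]. *)
Lemma drift_abs_list n s q M w (al : R) : siblings s ->
    {subset flatten [seq subtree n.+1 y | y <- s] <= M} ->
    {in s, forall y, avs p M (fun v => `|drift n y v|) w <= al} ->
  avs p M (fun v => `|D n s q v|) w <= al * dtail q (size s) l.
Proof.
elim: s q => [|y s IHs] [|q] sib sM Hal.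
- by rewrite /D /= normr0 avs_const mulr0.
- by rewrite /D /= normr0 avs_const mulr0.
- by rewrite /D /= normr0 avs_const mulr0.
have [yM sM'] := subset_flatten_cons sM.
have [sib' _] := siblings_cons dp_ch ch_inj sib.
have Hal' : {in s, forall z, avs p M (fun v => `|drift n z v|) w <= al}.
  by move=> z zs; apply: Hal; rewrite inE zs orbT.
apply: (@le_trans _ _ (avs p M (fun v =>
    `|drift n y v| * (X n s q v - X n s q.+1 v) +
    (psi n y v * `|D n s q v| +
     (`|D n s q.+1 v| - psi n y v * `|D n s q.+1 v|))) w)).
  apply: le_avs => // v; rewrite D_cons.
  have /andP[x0 _] := X_diff n s q v; have /andP[t0 t1] := psi_bounds ch m n y v a01.
  apply: le_trans (ler_normD _ _) _; rewrite normrM (ger0_norm x0) lerD2l.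
  have q0 : 0 <= 1 - psi n y v by rewrite subr_ge0.
  apply: le_trans (ler_normD _ _) _; rewrite !normrM (ger0_norm t0) (ger0_norm q0).
  by rewrite mulrBl mul1r.
have M1 G : (forall z, z \notin flatten [seq subtree n.+1 y | y <- s] -> indep z G) ->
    avs p M (fun v => psi n y v * G v) w = l * avs p M G w.
  move=> iG; rewrite (avs_siblingsM dp_ch ch_inj _ _ sib yM (@dep_psi n y) iG).
  by rewrite (avs_psi_l _ sM)// mem_head.
rewrite avsD avsD avsB !M1; last 2 first.
- by move=> z zs; apply: indep_comp1; exact: indep_D.
- by move=> z zs; apply: indep_comp1; exact: indep_D.
rewrite (avs_siblingsM dp_ch ch_inj _ _ sib yM); last 2 first.
- by move=> v v' vv'; rewrite (dep_drift vv').
- by move=> z zs v b; rewrite !(indep_X _ zs).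
rewrite avsB !avs_X// dtailS.
have := IHs q sib' sM' Hal'; have := IHs q.+1 sib' sM' Hal'.
have := Hal y (mem_head _ _); have [t0 t1 t2] := tail_bounds q (size s) l01.
case/andP: l01 => l0 l1.
set A := avs _ _ _ _; set B := avs _ _ _ _; set C := avs _ _ _ _.
move=> hA hB hC.
have := ler_wpM2l l0 hC.
have q0 : 0 <= 1 - l by rewrite subr_ge0.
have := ler_wpM2l q0 hB.
have t20 : 0 <= tail q (size s) l - tail q.+1 (size s) l by rewrite subr_ge0.
have := ler_wpM2r t20 hA.
lra.
Qed.

(** The squares keep the weights c, t and 1 - t, so the leading factor is not enlarged; only the
    cross term is bounded crudely. *)
Let sqr_mix_le (b c t d e : R) : 0 <= c <= 1 -> 0 <= t <= 1 ->
  (b * c + (t * d + (1 - t) * e)) ^+ 2 <=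
  b ^+ 2 * c + (2 * (`|b| * (`|d| + `|e|)) + (t * d ^+ 2 + (e ^+ 2 - t * e ^+ 2))).
Proof.
move=> /andP[c0 c1] /andP[t0 t1].
have h1 : (b * c) ^+ 2 <= b ^+ 2 * c.
  by rewrite exprMn ler_wpM2l ?sqr_ge0//; nra.
have h2 : (t * d + (1 - t) * e) ^+ 2 <= t * d ^+ 2 + (e ^+ 2 - t * e ^+ 2).
  have : 0 <= t * (1 - t) * (d - e) ^+ 2.
    by rewrite mulr_ge0 ?sqr_ge0// mulr_ge0// subr_ge0.
  lra.
have h3 : (b * c) * (t * d + (1 - t) * e) <= `|b| * (`|d| + `|e|).
  apply: le_trans (ler_norm _) _; rewrite !normrM; apply: ler_pM => //.
    by rewrite ler_piMr// ger0_norm.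
  apply: le_trans (ler_normD _ _) _; rewrite !normrM; apply: lerD.
    by rewrite ler_piMl// ger0_norm.
  by rewrite ler_piMl// ger0_norm ?subr_ge0//; lra.
rewrite sqrrD; lra.
Qed.

(** Diagonal terms reproduce the recursion of [dtail] with be. Cross terms factor by independence
    into products of first moments, so they contribute multiples of [al ^+ 2] that sum to at most
    the quadratic term in the size. *)
Lemma drift_sqr_list n s q M w (al be : R) : 0 <= al -> siblings s ->
    {subset flatten [seq subtree n.+1 y | y <- s] <= M} ->
    {in s, forall y, avs p M (fun v => `|drift n y v|) w <= al} ->
    {in s, forall y, avs p M (fun v => drift n y v ^+ 2) w <= be} ->
  avs p M (fun v => D n s q v ^+ 2) w <=
  be * dtail q (size s) l + 4 * (size s)%:R ^+ 2 * al ^+ 2.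
Proof.
move=> al0; elim: s q => [|y s IHs] [|q] sib sM Hal Hbe.
- by rewrite /D /= expr0n !mulr0 mul0r avs_const addr0.
- by rewrite /D /= expr0n !mulr0 mul0r avs_const addr0.
- rewrite /D /= expr0n mulr0 avs_const add0r.
  by rewrite mulr_ge0 ?sqr_ge0// mulr_ge0// sqr_ge0.
have [yM sM'] := subset_flatten_cons sM.
have [sib' _] := siblings_cons dp_ch ch_inj sib.
have Hal' : {in s, forall z, avs p M (fun v => `|drift n z v|) w <= al}.
  by move=> z zs; apply: Hal; rewrite inE zs orbT.
have Hbe' : {in s, forall z, avs p M (fun v => drift n z v ^+ 2) w <= be}.
  by move=> z zs; apply: Hbe; rewrite inE zs orbT.
apply: (@le_trans _ _ (avs p M (fun v =>
    drift n y v ^+ 2 * (X n s q v - X n s q.+1 v) +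
    (2 * (`|drift n y v| * (`|D n s q v| + `|D n s q.+1 v|)) +
    (psi n y v * D n s q v ^+ 2 +
     (D n s q.+1 v ^+ 2 - psi n y v * D n s q.+1 v ^+ 2)))) w)).
  apply: le_avs => // v; rewrite D_cons; apply: sqr_mix_le; first exact: X_diff.
  exact: psi_bounds.
have M1 G : (forall z, z \notin flatten [seq subtree n.+1 y | y <- s] -> indep z G) ->
    avs p M (fun v => psi n y v * G v) w = l * avs p M G w.
  move=> iG; rewrite (avs_siblingsM dp_ch ch_inj _ _ sib yM (@dep_psi n y) iG).
  by rewrite (avs_psi_l _ sM)// mem_head.
rewrite avsD avsD avsZ avsD avsB.
rewrite (M1 (fun v => D n s q v ^+ 2)); last first.
  by move=> z zs v b; rewrite (indep_D _ zs).
rewrite (M1 (fun v => D n s q.+1 v ^+ 2)); last first.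
  by move=> z zs v b; rewrite (indep_D _ zs).
rewrite (avs_siblingsM dp_ch ch_inj _ _ sib yM); last 2 first.
- by move=> v v' vv'; rewrite (dep_drift vv').
- by move=> z zs v b; rewrite !(indep_X _ zs).
rewrite (avs_siblingsM dp_ch ch_inj _ _ sib yM (F := fun v => `|drift n y v|)
  (G := fun v => `|D n s q v| + `|D n s q.+1 v|)); last 2 first.
- by move=> v v' vv'; rewrite (dep_drift vv').
- by move=> z zs v b; rewrite !(indep_D _ zs).
rewrite avsB !avs_X// dtailS avsD.
have H1 := drift_abs_list q sib' sM' Hal'.
have H2 := drift_abs_list q.+1 sib' sM' Hal'.
have := IHs q sib' sM' Hal' Hbe'; have := IHs q.+1 sib' sM' Hal' Hbe'.
have [t0 t1 t2] := tail_bounds q (size s) l01.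
have /andP[d0 d1] := dtail_bounds q (size s) l01.
have /andP[e0 e1] := dtail_bounds q.+1 (size s) l01.
have hy := Hal y (mem_head _ _); have hy2 := Hbe y (mem_head _ _).
have y0 : 0 <= avs p M (fun v => `|drift n y v|) w by apply: avs_ge0.
have z0 : 0 <= avs p M (fun v => `|D n s q v|) w by apply: avs_ge0.
have z1 : 0 <= avs p M (fun v => `|D n s q.+1 v|) w by apply: avs_ge0.
case/andP: l01 => l0 l1; have q0 : 0 <= 1 - l by rewrite subr_ge0.
have t20 : 0 <= tail q (size s) l - tail q.+1 (size s) l by rewrite subr_ge0.
move=> /(ler_wpM2l q0) hB /(ler_wpM2l l0) hC.
have hA := ler_wpM2r t20 hy2.
have hX := ler_pM y0 (addr_ge0 z0 z1) hy (lerD H1 H2).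
have hs : al ^+ 2 * (dtail q (size s) l + dtail q.+1 (size s) l) <=
    al ^+ 2 * (2 * (size s)%:R).
  by rewrite ler_wpM2l ?sqr_ge0//; lra.
have := sqr_ge0 al.
have := ler0n R (size s).
have hS : 0 <= (size s)%:R * al ^+ 2 by rewrite mulr_ge0 ?sqr_ge0.
rewrite -[(size (y :: s))%:R]natr1.
move: hX hA hB hC hs hS.
move: (avs _ _ (fun v => D n s q v ^+ 2) _).
move: (avs _ _ (fun v => D n s q.+1 v ^+ 2) _).
move: (avs _ _ (fun v => drift n y v ^+ 2) _) (size s)%:R.
set W := _ * (_ + _) => B S Q P.
move: (tail _ _ _) (tail _ _ _) (dtail _ _ _) (dtail _ _ _) => *.
lra.
Qed.

Let rho := p * dtail m k l.

Let rho0 : 0 <= rho.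
Proof.
by case/andP: p01 => p0 _; rewrite mulr_ge0//; case/andP: (dtail_bounds m k l01).
Qed.

Let below_sub n x M : {subset subtree n.+1 x <= M} -> {subset below n x <= M}.
Proof. by move=> xM y yb; apply: xM; rewrite subtreeS inE yb orbT. Qed.

Let ch_sub n x M : {subset subtree n.+1 x <= M} ->
  {in ch x, forall y, {subset subtree n y <= M}}.
Proof.
by move=> xM y yx z zy; apply: (below_sub xM); apply/flatten_mapP; exists y.
Qed.

Let drift0_le x w : `|drift 0 x w| <= 1.
Proof.
rewrite /= normrM mulr_ile1//.
  by case: (removable _ _ _ _ _); rewrite ?normr1 ?normr0// ler01.
case/andP: a01 => a0 a1; case/andP: p01 => p0 p1.
rewrite normrM mulr_ile1// ?(ger0_norm a0)//.
by rewrite ler_norml; case: (w x) => /=; lra.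
Qed.

Let indep_D_root n x q : indep x (D n (ch x) q).
Proof. by apply: indep_D; exact: (notin_below dp_ch n.+1). Qed.

Lemma drift_abs n x M w : {subset subtree n.+1 x <= M} ->
  avs p M (fun v => `|drift n x v|) w <= rho ^+ n.
Proof.
elim: n x => [|n IHn] x xM.
  by rewrite expr0 -(@avs_const _ _ p M 1 w) le_avs.
rewrite (_ : (fun v => _) = fun v : V -> bool => (v x)%:R * `|D n (ch x) m v|); last first.
  by apply/funext => v; rewrite /= normrM ger0_norm.
have xM1 : x \in M by apply: xM; rewrite mem_head.
rewrite avs_occupied//; last by apply: indep_comp1; exact: indep_D_root.
rewrite exprS -mulrA ler_wpM2l//; first by case/andP: p01.
rewrite mulrC -(size_ch x); apply: drift_abs_list => //.
- exact: siblings_ch.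
- exact: below_sub.
by move=> y yx; apply: IHn; exact: (ch_sub xM).
Qed.

(** One generation multiplies the second moment by rho and adds at most 4 k^2 rho^(2n). A rate sigma
    above rho absorbs the addition once K (sigma - rho) is at least 4 k^2. *)
Lemma drift_sqr n x M w (K sigma : R) : {subset subtree n.+1 x <= M} ->
    rho < sigma -> sigma <= 1 -> 1 + 4 * k%:R ^+ 2 / (sigma - rho) <= K ->
  avs p M (fun v => drift n x v ^+ 2) w <= K * sigma ^+ n.
Proof.
move=> + rs s1 hK.
have sr0 : 0 < sigma - rho by rewrite subr_gt0.
have K1 : 1 <= K.
  by apply: le_trans hK; rewrite lerDl divr_ge0 ?mulr_ge0 ?sqr_ge0// ltW.
have hK' : 4 * k%:R ^+ 2 <= (sigma - rho) * K.
  by rewrite -ler_pdivrMl// mulrC; apply: le_trans hK; rewrite lerDr.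
elim: n x => [|n IHn] x xM.
  rewrite expr0 mulr1; apply: le_trans K1.
  rewrite -(@avs_const _ _ p M 1 w) le_avs// => v.
  by rewrite -real_normK ?num_real// exprn_ile1.
rewrite (_ : (fun v => _) = fun v : V -> bool => (v x)%:R * D n (ch x) m v ^+ 2); last first.
  by apply/funext => v; rewrite /= exprMn; case: (v x); rewrite ?expr1n ?expr0n.
have xM1 : x \in M by apply: xM; rewrite mem_head.
rewrite avs_occupied//; last first.
  by move=> v b; rewrite (indep_D_root n x m).
have sn0 : 0 <= sigma ^+ n by rewrite exprn_ge0// (le_trans rho0)// ltW.
have H : avs p M (fun v => D n (ch x) m v ^+ 2) w <=
    (K * sigma ^+ n) * dtail m (size (ch x)) l +
    4 * (size (ch x))%:R ^+ 2 * (rho ^+ n) ^+ 2.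
  apply: drift_sqr_list.
  - exact: exprn_ge0.
  - exact: siblings_ch.
  - exact: below_sub.
  - by move=> y yx; apply: drift_abs; exact: (ch_sub xM).
  by move=> y yx; apply: IHn; exact: (ch_sub xM).
rewrite size_ch in H; case/andP: p01 => p0 p1.
apply: le_trans (ler_wpM2l p0 H) _.
have rn : (rho ^+ n) ^+ 2 <= sigma ^+ n.
  apply: (@le_trans _ _ (rho ^+ n)).
    rewrite expr2 ler_piMl ?exprn_ge0// exprn_ile1//.
    by rewrite (le_trans _ s1)// ltW.
  have s0 : 0 <= sigma by exact: le_trans rho0 (ltW rs).
  by apply: lerXn2r; rewrite ?nnegrE// ltW.
have h1 : 4 * k%:R ^+ 2 * (rho ^+ n) ^+ 2 <= 4 * k%:R ^+ 2 * sigma ^+ n.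
  by rewrite ler_wpM2l// mulr_ge0// sqr_ge0.
have h2 := ler_wpM2r sn0 hK'.
have h3 : p * (4 * k%:R ^+ 2 * (rho ^+ n) ^+ 2) <= 4 * k%:R ^+ 2 * (rho ^+ n) ^+ 2.
  apply: ler_piMl => //; apply: mulr_ge0; last exact: sqr_ge0.
  by rewrite mulr_ge0// sqr_ge0.
have rE : p * (K * sigma ^+ n * dtail m k l) = K * sigma ^+ n * rho.
  by rewrite /rho; ring.
rewrite mulrDr rE.
apply: le_trans (lerD (lexx _) (le_trans h3 (le_trans h1 h2))) _.
by rewrite le_eqVlt; apply/orP; left; apply/eqP; rewrite exprS; ring.
Qed.

End drift_moments.

(** * Binomial tails and stability of the fixed point *)

Section binomial_tail.
Context (R : realType).
Implicit Types (m k i : nat) (l s t : R).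

Definition binomial_pmf k m l : R := 'C(k, m)%:R * l ^+ m * (1 - l) ^+ (k - m).

Lemma binomial_pmfS k m l : binomial_pmf k.+1 m.+1 l =
  l * binomial_pmf k m l + (1 - l) * binomial_pmf k m.+1 l.
Proof.
rewrite /binomial_pmf binS natrD subSS.
have [km|mk] := leqP k m.
  by rewrite (@bin_small k m.+1)// !exprS; ring.
have -> : (k - m = (k - m.+1).+1)%N by lia.
by rewrite !exprS; ring.
Qed.

Lemma binomial_pmf0S k l : binomial_pmf k.+1 0 l = (1 - l) * binomial_pmf k 0 l.
Proof. by rewrite /binomial_pmf !bin0 !subn0 exprS; ring. Qed.

Lemma tail0 k l : tail 0 k l = 1.
Proof. exact: atleast0. Qed.

Lemma dtail0 k l : dtail 0 k l = 0.
Proof. exact: datleast0. Qed.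

Lemma tailB k m l : tail m k l - tail m.+1 k l = binomial_pmf k m l.
Proof.
elim: k m => [|k IHk] [|m].
- by rewrite /tail /= /binomial_pmf bin0 !expr0; ring.
- by rewrite /tail /= /binomial_pmf bin_small// !mul0r subrr.
- rewrite tailS !tail0 binomial_pmf0S -IHk tail0; ring.
- by rewrite !tailS binomial_pmfS -!IHk; ring.
Qed.

Lemma dtailE k m l : dtail m.+1 k.+1 l = k.+1%:R * binomial_pmf k m l.
Proof.
elim: k m => [|k IHk] m.
  have d0 q : dtail q 0 l = 0 by case: q.
  by rewrite dtailS tailB !d0 mul1r; ring.
rewrite dtailS tailB IHk; case: m => [|m].
  by rewrite dtail0 binomial_pmf0S -[k.+2%:R]natr1; ring.
by rewrite IHk binomial_pmfS -[k.+2%:R]natr1; ring.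
Qed.

Lemma mul_dtail k m l : l * dtail m k l = m%:R * binomial_pmf k m l.
Proof.
case: m => [|m]; first by rewrite dtail0 mulr0 mul0r.
case: k => [|k]; first by rewrite /dtail /= /binomial_pmf bin_small// !mul0r !mulr0.
rewrite dtailE /binomial_pmf subSS.
have := congr1 (fun n => n%:R : R) (mul_bin_diag k.+1 m).
rewrite /= !natrM => H.
transitivity (k.+1%:R * 'C(k, m)%:R * (l ^+ m.+1 * (1 - l) ^+ (k - m))).
  by rewrite exprS; ring.
by rewrite H exprS; ring.
Qed.

Lemma tail_sum k m l : (m <= k)%N ->
  tail m k l = \sum_(m <= i < k.+1) binomial_pmf k i l.
Proof.
move=> mk; under eq_bigr do rewrite -tailB -opprB.
rewrite sumrN telescope_sumr ?leqW// opprB.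
rewrite [X in _ - X](_ : _ = 0) ?subr0//.
apply: atleast_eq0; apply: (@leq_ltn_trans k); rewrite ?ltnSn//.
by rewrite -[leqRHS](size_nseq k l) count_size.
Qed.

(** Monotone likelihood ratio, cross-multiplied: the ratio of the masses at i and m is proportional
    to the power i - m of l / (1 - l). *)
Lemma binomial_pmf_ratio k m i s t : 0 <= s -> s <= t -> t <= 1 ->
    (m <= i)%N -> (i <= k)%N ->
  binomial_pmf k i s * binomial_pmf k m t <= binomial_pmf k i t * binomial_pmf k m s.
Proof.
move=> s0 st t1 mi ik; rewrite /binomial_pmf.
have [d iE] : exists d, i = (m + d)%N by exists (i - m)%N; lia.
subst i.
have -> : (k - m = (k - (m + d)) + d)%N by lia.
set e := (k - _)%N; set c := 'C(k, m + d)%:R; set b := 'C(k, m)%:R.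
pose z := c * b * (s ^+ m * t ^+ m * (1 - s) ^+ e * (1 - t) ^+ e).
have t0 : 0 <= t by exact: le_trans st.
have [qs qt] : 0 <= 1 - s /\ 0 <= 1 - t by lra.
have z0 : 0 <= z.
  apply: mulr_ge0; first exact: mulr_ge0.
  by do 3![apply: mulr_ge0; rewrite ?exprn_ge0//].
have -> : c * s ^+ (m + d) * (1 - s) ^+ e * (b * t ^+ m * (1 - t) ^+ (e + d)) =
    z * (s ^+ d * (1 - t) ^+ d) by rewrite /z !exprD; ring.
have -> : c * t ^+ (m + d) * (1 - t) ^+ e * (b * s ^+ m * (1 - s) ^+ (e + d)) =
    z * (t ^+ d * (1 - s) ^+ d) by rewrite /z !exprD; ring.
rewrite ler_wpM2l// -!exprMn.
have h : s * (1 - t) <= t * (1 - s) by lra.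
by apply: lerXn2r; rewrite ?nnegrE ?mulr_ge0.
Qed.

(* The elasticity [l * dtail l / tail l] of the binomial tail is nonincreasing. *)
Lemma tail_elasticity k m s t : (m <= k)%N -> 0 <= s -> s <= t -> t <= 1 ->
  tail m k s * (t * dtail m k t) <= tail m k t * (s * dtail m k s).
Proof.
move=> mk s0 st t1; rewrite !mul_dtail !tail_sum//.
rewrite mulrCA [leRHS]mulrCA ler_wpM2l// !mulr_suml.
rewrite !big_seq; apply: ler_sum => i; rewrite mem_index_iota ltnS.
by move=> /andP[mi ik]; exact: binomial_pmf_ratio.
Qed.

Lemma is_derive_tail k m l : is_derive l 1 (tail m k) (dtail m k l).
Proof.
elim: k m => [|k IHk] [|m].
- by rewrite dtail0 (_ : tail _ _ = cst 1); [exact: is_derive_cst|exact/funext/tail0].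
- by rewrite (_ : tail _ _ = cst 0) //; exact: is_derive_cst.
- by rewrite dtail0 (_ : tail _ _ = cst 1); [exact: is_derive_cst|exact/funext/tail0].
rewrite (_ : tail _ _ = id * tail m k + (cst 1 - id) * tail m.+1 k); last first.
  by apply/funext => u; rewrite tailS.
have h1 := IHk m; have h2 := IHk m.+1.
apply: is_derive_eq; rewrite dtailS /GRing.scale /=.
by rewrite !fctE; ring.
Qed.

Lemma continuous_tail k m : continuous (tail m k : R -> R).
Proof.
move=> l; apply: differentiable_continuous; apply/derivable1_diffP.
by have [] := is_derive_tail k m l.
Qed.

(** The quotient [tail m k l / l] is at least 1 / p1 at l1 and equals 1 / p2 < 1 / p1 at l2, so its
    derivative is negative at some s in between. There the elasticity of [tail] is below 1, and by
    monotonicity it is below 1 at l2 too. *)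
Lemma stable_fixed_point k m (p1 p2 l1 l2 : R) : (m <= k)%N ->
    0 < p1 -> p1 < p2 -> 0 < l1 -> l1 <= l2 -> l2 < 1 ->
    l1 <= p1 * tail m k l1 -> p2 * tail m k l2 = l2 ->
  p2 * dtail m k l2 < 1.
Proof.
move=> mk p10 p12 l10 l12 l21 h1 h2; have p20 := lt_trans p10 p12.
have l20 := lt_le_trans l10 l12.
have t2 : 0 < tail m k l2.
  by rewrite -(pmulr_rgt0 _ p20) h2.
have {}l12 : l1 < l2.
  rewrite lt_neqAle l12 andbT; apply/eqP => l12E; move: h1; rewrite l12E -{1}h2.
  by rewrite leNgt ltr_pM2r// p12.
have dphi s : 0 < s ->
    is_derive s 1 (fun u => tail m k u * u^-1)
      ((s * dtail m k s - tail m k s) / s ^+ 2).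
  move=> s0; have hs := is_derive_tail k m s.
  have hV : is_derive s 1 (fun u : R => u^-1) (- s ^- 2).
    apply: is_derive_eq; first by apply: (@is_deriveV _ id s 1 1); rewrite ?gt_eqF.
    by rewrite /GRing.scale /= mulr1.
  apply: is_derive_eq; rewrite /GRing.scale /=.
  by field; rewrite gt_eqF.
have pos u : u \in `[l1, l2] -> 0 < u.
  by rewrite in_itv /= => /andP[+ _]; exact: lt_le_trans.
have [||s] := @MVT R (fun u => tail m k u * u^-1)
  (fun s => (s * dtail m k s - tail m k s) / s ^+ 2) l1 l2 l12.
- by move=> u ul; apply/dphi/pos; exact: subset_itv_oo_cc ul.
- apply: derivable_within_continuous => u /pos /dphi du.
  exact: @ex_derive _ _ _ _ _ _ _ du.
rewrite in_itv /= => /andP[l1s sl2] E.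
have s0 := lt_trans l10 l1s.
have phi2 : tail m k l2 * l2^-1 = p2^-1.
  by rewrite -[in l2^-1]h2 invfM mulrCA divff ?mulr1// gt_eqF.
have phi1 : p1^-1 <= tail m k l1 * l1^-1.
  by rewrite ler_pdivlMr// mulrC ler_pdivrMr// mulrC.
have ss : s * dtail m k s < tail m k s.
  have : tail m k l2 * l2^-1 - tail m k l1 * l1^-1 < 0.
    rewrite phi2 subr_lt0; apply: lt_le_trans phi1.
    by rewrite ltf_pV2.
  rewrite E pmulr_llt0 ?subr_gt0// pmulr_llt0 ?invr_gt0 ?exprn_gt0//.
  by rewrite subr_lt0.
have s1 : s <= 1 by rewrite ltW// (lt_trans sl2).
have /andP[d0 _] := @dtail_bounds R m k s (introT andP (conj (ltW s0) s1)).
have ts : 0 < tail m k s by apply: le_lt_trans ss; rewrite mulr_ge0// ltW.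
have el := tail_elasticity mk (ltW s0) (ltW sl2) (ltW l21).
have : tail m k s * (l2 * dtail m k l2) < tail m k s * tail m k l2.
  by apply: le_lt_trans el _; rewrite [ltRHS]mulrC ltr_pM2l.
rewrite ltr_pM2l// => h; rewrite -(ltr_pM2l l20) mulr1 mulrCA.
by rewrite -[ltRHS]h2 ltr_pM2l.
Qed.

(** Started from 1, the recursion is nonincreasing and stays above l1. By continuity its limit is a
    fixed point, positive because of the barrier l1. *)
Lemma survival_cvg k m (p1 p2 l1 : R) : (m <= k)%N ->
    0 < p1 -> p1 < p2 -> p2 < 1 -> 0 < l1 -> l1 <= 1 ->
    l1 <= p1 * tail m k l1 ->
  exists l, [/\ 0 < l < 1, p2 * tail m k l = l, p2 * dtail m k l < 1 &
    survival m k p2 1 n @[n --> \oo] --> l].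
Proof.
move=> mk p10 p12 p21 l10 l11 h1; have p20 := lt_trans p10 p12.
have p01 : 0 <= p2 <= 1 by rewrite !ltW.
have u01 n : 0 <= survival m k p2 1 n <= 1.
  by apply: survival_bounds => //; rewrite ler01 lexx.
have t01 := tail_bounds m k (introT andP (conj (ltW l10) l11)).
have l1u n : l1 <= survival m k p2 1 n.
  elim: n => [|n IHn] /=.
    rewrite mulr1; apply: le_trans h1 _; case: t01 => t0 t1 _.
    by apply: le_trans (ltW p12); apply: ler_piMr => //; exact: ltW.
  apply: le_trans h1 _; apply: ler_pM; [exact: ltW|by case: t01|exact: ltW|].
  by apply: le_tail => //; [exact: ltW|case/andP: (u01 n)].
have dec : nonincreasing_seq (survival m k p2 1).
  apply/nonincreasing_seqP; elim => [|n IHn] /=.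
    have [_ t1 _] := tail_bounds m k (u01 0%N).
    by rewrite ler_wpM2l// ltW.
  rewrite ler_pM2l//; apply: le_tail; [by case/andP: (u01 n.+1)|exact: IHn|].
  by case/andP: (u01 n).
have cu : cvgn (survival m k p2 1).
  apply: nonincreasing_is_cvgn => //; exists 0 => _ [n _ <-].
  by case/andP: (u01 n).
pose l := limn (survival m k p2 1).
have l1l : l1 <= l by apply: limr_ge => //; near=> n.
have lu n : l <= survival m k p2 1 n by exact: nonincreasing_cvgn_ge.
have l0 := lt_le_trans l10 l1l.
(* The limit is at most the initial term, which is p2. *)
have l1' : l < 1 by rewrite (le_lt_trans (lu 0%N))//= mulr1.
have fixl : p2 * tail m k l = l.
  apply: (@cvg_unique _ (@Rhausdorff R) (survival m k p2 1 n.+1 @[n --> \oo])).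
    apply: cvgM; first exact: cvg_cst.
    by apply: continuous_cvg cu; exact: continuous_tail.
  suff : [sequence survival m k p2 1 n.+1]_n @ \oo --> l by [].
  by rewrite cvg_shiftS.
exists l; split => //; first by rewrite l0.
exact: (stable_fixed_point mk p10 p12 l10).
Unshelve. all: by end_near. Qed.

End binomial_tail.

(** * Local functions and L2 limits *)

Section local_functions.
Context (R : realType) (V : countType) (p : R).
Hypothesis p01 : 0 <= p <= 1.
Local Notation mu := (bernoulli_field V p).
Implicit Types (w : config V) (S T : seq V) (F : config V -> R).

Lemma measurable_coord x b : measurable [set w : config V | w x = b].
Proof.
have mT : measurable [set w : config V | w x].
  by apply: sub_sigma_algebra; exists x.
case: b; first exact: mT.
rewrite (_ : mkset _ = ~` [set w : config V | w x]); first exact: measurableC.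
by apply/seteqP; split => w /=; [move=> ->|move/negP/negbTE].
Qed.

Definition cylinder S (b : V -> bool) : set (config V) :=
  [set w | forall x, x \in S -> w x = b x].

Lemma measurable_cylinder S b : measurable (cylinder S b).
Proof.
elim: S => [|x S IHS].
  by rewrite (_ : cylinder _ _ = setT)//; apply/seteqP; split.
rewrite (_ : cylinder _ _ = [set w | w x = b x] `&` cylinder S b).
  by apply: measurableI => //; exact: measurable_coord.
apply/seteqP; split => w.
  by move=> wS; split=> [|y yS]; apply: wS; rewrite inE ?eqxx// yS orbT.
by move=> [wx wS] y; rewrite inE => /predU1P[->//|/wS].
Qed.

Lemma upd_split (F : (V -> bool) -> R) x : F = fun w =>
  if w x then F (upd w x true) else F (upd w x false).
Proof.
by apply/funext => w; rewrite -{1}(upd_id w x); case: (w x).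
Qed.

Lemma measurable_local S F : depends_on S F -> measurable_fun [set: config V] F.
Proof.
elim: S F => [|x S IHS] F dF.
  rewrite (_ : F = cst (F (fun=> true))); first exact: measurable_cst.
  by apply/funext => w; apply: dF.
rewrite (upd_split F x); apply: measurable_fun_ifT.
- apply: (@measurable_fun_bool _ _ _ _ true); rewrite setTI.
  exact: (measurable_coord x true).
- by apply: IHS; exact: depends_on_upd.
by apply: IHS; exact: depends_on_upd.
Qed.

Lemma local_bounded S F : depends_on S F -> exists M, forall w, `|F w| <= M.
Proof.
elim: S F => [|x S IHS] F dF.
  by exists `|F (fun=> true)| => w; rewrite (dF w (fun=> true)).
have [M1 H1] := IHS _ (depends_on_upd true dF).
have [M2 H2] := IHS _ (depends_on_upd false dF).
exists (Num.max M1 M2) => w; rewrite (upd_split F x) le_max.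
by case: (w x); rewrite ?H1 ?H2 ?orbT.
Qed.

Lemma integrable_local S F : depends_on S F ->
  mu.-integrable [set: config V] (EFin \o F).
Proof.
move=> dF; apply: measurable_bounded_integrable => //.
- by apply: le_lt_trans (probability_le1 _ _) _ => //; rewrite ltry.
- exact: measurable_local dF.
have [M HM] := local_bounded dF; exists M; split; first exact: num_real.
by move=> y My w _; rewrite /= (le_trans (HM w))// ltW.
Qed.

Lemma bernoulli_prob1 b :
  bernoulli_prob p [set b] = (if b then p else 1 - p)%:E.
Proof. by rewrite /bernoulli_prob p01 fsbig_set1. Qed.

Lemma cylinder_prob S b : uniq S ->
  mu (cylinder S b) = (\prod_(x <- S) (if b x then p else 1 - p))%:E.
Proof.
move=> uS; rewrite product_measureE// -prodEFin.
by apply: eq_bigr => x _; exact: bernoulli_prob1.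
Qed.

(** T holds the sites already fixed: the induction moves the head of S into T by splitting the
    cylinder according to its state. *)
Lemma integral_local_cylinder S T F b : uniq (S ++ T) -> depends_on (S ++ T) F ->
  (\int[mu]_(w in cylinder T b) (F w)%:E =
   (avs p S F b * \prod_(x <- T) (if b x then p else 1 - p))%:E)%E.
Proof.
elim: S T b => [|x S IHS] T b uST dF.
  rewrite (eq_integral (cst (F b)%:E)); last first.
    by move=> w; rewrite inE => wT; rewrite (dF w b).
  rewrite integral_cst; last exact: measurable_cylinder.
  by rewrite EFinM; congr (_ * _)%E; exact: cylinder_prob.
have uSxT : uniq (S ++ x :: T).
  by rewrite -(perm_uniq (permEl (perm_catCA [:: x] S T))).
have dSxT : depends_on (S ++ x :: T) F.
  apply: depends_onW dF => y; rewrite /= !(inE, mem_cat).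
  by case: (y == x); case: (y \in S).
have xT : x \notin T.
  by move: uST; rewrite /= mem_cat negb_or => /andP[/andP[]].
have cE : cylinder T b =
    cylinder (x :: T) (upd b x true) `|` cylinder (x :: T) (upd b x false).
  apply/seteqP; split => w.
    move=> wT; case wx : (w x); [left|right] => y; rewrite inE => /predU1P[->|yT].
    - by rewrite upd_eq.
    - by rewrite upd_neq ?wT//; apply: contraNneq xT => <-.
    - by rewrite upd_eq.
    - by rewrite upd_neq ?wT//; apply: contraNneq xT => <-.
  case=> wT y yT; rewrite wT ?inE ?yT ?orbT// upd_neq//.
    by apply: contraNneq xT => <-.
  by apply: contraNneq xT => <-.
rewrite cE integral_setU; first last.
- apply/disj_setPS => w [/(_ x) wt /(_ x) wf].
  have := wt (mem_head _ _); have := wf (mem_head _ _).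
  by rewrite !upd_eq => ->.
- apply/measurable_EFinP; apply: measurable_funTS; exact: measurable_local dF.
- exact: measurable_cylinder.
- exact: measurable_cylinder.
rewrite !IHS// -EFinD /= /av !big_cons !upd_eq; congr EFin.
have E c : \prod_(y <- T) (if upd b x c y then p else 1 - p) =
    \prod_(y <- T) (if b y then p else 1 - p).
  rewrite big_seq [RHS]big_seq; apply: eq_bigr => y yT; rewrite upd_neq//.
  by apply: contraNneq xT => <-.
by rewrite !E; ring.
Qed.

Lemma integral_local S F b : uniq S -> depends_on S F ->
  (\int[mu]_w (F w)%:E = (avs p S F b)%:E)%E.
Proof.
move=> uS dF; have := @integral_local_cylinder S [::] F b.
rewrite cats0 big_nil mulr1 => /(_ uS dF) <-; congr (integral _ _ _).
by apply/seteqP; split.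
Qed.

Lemma Rintegral_local S F b : uniq S -> depends_on S F ->
  \int[mu]_w F w = avs p S F b.
Proof. by move=> uS dF; rewrite /Rintegral (integral_local b uS dF). Qed.

Lemma site_averageE x F : site_average p x F = av p x F.
Proof.
apply/funext => w; rewrite /site_average /av.
pose g b := F (upd w x b).
rewrite -[LHS]/(\int[bernoulli_prob p]_b g b) -[RHS]/(p * g true + (1 - p) * g false).
have ig D : measurable D -> (bernoulli_prob p).-integrable D (EFin \o g).
  move=> mD; apply: measurable_bounded_integrable => //.
    by apply: le_lt_trans (probability_le1 (bernoulli_prob p) _) _ => //; rewrite ltry.
  exists (`|g true| + `|g false|); split; first exact: num_real.
  move=> y My b _; apply: le_trans (ltW My).
  by case: b; rewrite /= ?lerDl ?lerDr.
have E b : \int[bernoulli_prob p]_(c in [set b]) g c = g b * (if b then p else 1 - p).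
  rewrite (@eq_Rintegral _ _ _ _ _ (cst (g b))) => [|c]; last by rewrite inE => ->.
  rewrite Rintegral_cst//; congr (_ * _).
  by have := congr1 fine (bernoulli_prob1 b).
rewrite setT_bool Rintegral_setU//.
- by rewrite !E; ring.
- exact: ig.
by apply/disj_setPS => c [/= -> ].
Qed.

End local_functions.

(** * Inner products and limits in L^2 *)

Section L2_limits.
Context d (T : measurableType d) (R : realType) (mu : probability T R).
Implicit Types (f g u v : T -> R).
Local Notation L2 := (Lfun mu 2%:E).
Local Notation I f := (\int[mu]_x f x).
Local Notation N2 f := ('N[mu]_2%:E [EFin \o f])%E.

Lemma Lfun_measurable r f : f \in Lfun mu r -> measurable_fun [set: T] f.
Proof. by case/andP; rewrite inE. Qed.

Lemma L2_integrable_mul u v : u \in L2 -> v \in L2 ->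
  mu.-integrable setT (EFin \o (fun x => u x * v x)).
Proof. by move=> u2 v2; apply/Lfun1_integrable; exact: Lfun2_mul_Lfun1. Qed.

Lemma L2_integrable u : u \in L2 -> mu.-integrable setT (EFin \o u).
Proof.
by move=> u2; apply/Lfun1_integrable/Lfun_subset12 => //; exact: fin_num_measure.
Qed.

Lemma abs_poweR2 (x : R) : (`|x%:E| `^ 2 = (x ^+ 2)%:E)%E.
Proof. by rewrite abse_EFin poweR_EFin powR_mulrn// real_normK// num_real. Qed.

Lemma L2_intro u : measurable_fun [set: T] u ->
  mu.-integrable setT (EFin \o (fun x => u x ^+ 2)) -> u \in L2.
Proof.
move=> mu_ iu; apply/andP; split; rewrite inE//= /finite_norm unlock.
apply: poweR_lty; under eq_integral do rewrite abs_poweR2.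
exact: integrable_lty iu.
Qed.

Lemma bounded_L2 u M : measurable_fun [set: T] u -> (forall x, `|u x| <= M) ->
  u \in L2.
Proof.
move=> mu_ uM; apply: L2_intro => //; apply: measurable_bounded_integrable => //.
- by apply: le_lt_trans (probability_le1 _ _) _ => //; rewrite ltry.
- exact: measurable_funX.
exists (M ^+ 2); split; first exact: num_real.
move=> y My x _; apply: le_trans (ltW My).
by rewrite normrX lerXn2r// nnegrE// (le_trans (normr_ge0 _) (uM x)).
Qed.

Lemma N2E u : u \in L2 -> N2 u = (Num.sqrt (I (fun x => u x ^+ 2)))%:E.
Proof.
move=> u2; have iu := Lfun2_integrable_sqr u2.
rewrite unlock; under eq_integral do rewrite abs_poweR2.
rewrite -powR12_sqrt; last by apply: Rintegral_ge0 => x _; exact: sqr_ge0.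
rewrite -poweR_EFin; congr (_ `^ _)%E.
by rewrite /Rintegral fineK// integrable_fin_num.
Qed.

Lemma cvg_N2 (u : nat -> T -> R) : (forall n, u n \in L2) ->
  I (fun x => u n x ^+ 2) @[n --> \oo] --> (0 : R) ->
  (fun n => N2 (u n)) @ \oo --> 0%E.
Proof.
move=> u2 cu; rewrite (_ : (fun n => _) =
  EFin \o (fun n => Num.sqrt (I (fun x => u n x ^+ 2)))); last first.
  by apply/funext => n; rewrite N2E.
apply: cvg_EFin; first by near=> n.
rewrite -[X in _ --> X](@sqrtr0 R).
by apply: continuous_cvg cu; exact: sqrt_continuous.
Unshelve. all: by end_near. Qed.

Lemma Rintegral_mul_le u v : u \in L2 -> v \in L2 ->
  `|I (fun x => u x * v x)| <= fine (N2 u) * fine (N2 v).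
Proof.
move=> u2 v2; have mu_ := Lfun_measurable u2; have mv := Lfun_measurable v2.
apply: le_trans (le_normr_Rintegral _ _) _ => //; first exact: L2_integrable_mul.
have H : ('N[mu]_1[EFin \o (u \* v)%R] <= N2 u * N2 v)%E.
  by apply: (@hoelder _ _ _ mu u v 2 2) => //; rewrite [RHS]splitr !div1r.
rewrite (N2E u2) (N2E v2) -EFinM in H.
rewrite (N2E u2) (N2E v2) /= -lee_fin; apply: le_trans H.
rewrite Lnorm1 /Rintegral fineK//.
apply: integrable_fin_num => //.
have := integrable_abse (L2_integrable_mul u2 v2).
by apply: eq_integrable => // x _.
Qed.

(** Expand u v - f g as (u - f)(v - g) + (u - f) g + f (v - g) and apply Cauchy-Schwarz to each
    product. *)
Lemma cvg_Rintegral_mul (u v : nat -> T -> R) f g : f \in L2 -> g \in L2 ->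
  (forall n, u n \in L2) -> (forall n, v n \in L2) ->
  (fun n => N2 (u n \- f)%R) @ \oo --> 0%E ->
  (fun n => N2 (v n \- g)%R) @ \oo --> 0%E ->
  I (fun x => u n x * v n x) @[n --> \oo] --> I (fun x => f x * g x).
Proof.
move=> f2 g2 u2 v2 cu cv.
have uf n : (u n \- f) \in L2 by rewrite rpredB ?lee1n.
have vg n : (v n \- g) \in L2 by rewrite rpredB ?lee1n.
pose a n := fine (N2 (u n \- f)%R); pose b n := fine (N2 (v n \- g)%R).
have ca : a n @[n --> \oo] --> 0 by exact: fine_cvg cu.
have cb : b n @[n --> \oo] --> 0 by exact: fine_cvg cv.
have nb n : `|I (fun x => u n x * v n x) - I (fun x => f x * g x)| <=
    a n * b n + a n * fine (N2 g) + fine (N2 f) * b n.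
  have -> : I (fun x => u n x * v n x) - I (fun x => f x * g x) =
      I (fun x => (u n \- f) x * (v n \- g) x) + I (fun x => (u n \- f) x * g x)
      + I (fun x => f x * (v n \- g) x).
    have iA := L2_integrable_mul (uf n) (vg n).
    have iB := L2_integrable_mul (uf n) g2.
    have iC := L2_integrable_mul f2 (vg n).
    have iAB := integrableD measurableT iA iB.
    rewrite -(RintegralD measurableT iA iB) -(RintegralD measurableT iAB iC).
    rewrite -(RintegralB measurableT (L2_integrable_mul (u2 n) (v2 n))
      (L2_integrable_mul f2 g2)).
    by apply: eq_Rintegral => x _ /=; ring.
  apply: le_trans (ler_normD _ _) _; apply: lerD; last exact: Rintegral_mul_le.
  apply: le_trans (ler_normD _ _) _; apply: lerD; exact: Rintegral_mul_le.
have c0 : a n * b n + a n * fine (N2 g) + fine (N2 f) * b n @[n --> \oo] --> 0.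
  rewrite [X in _ --> X](_ : 0 = 0 * 0 + 0 * fine (N2 g) + fine (N2 f) * 0).
    apply: cvgD; first apply: cvgD; apply: cvgM => //; exact: cvg_cst.
  by rewrite !mul0r mulr0 !addr0.
apply/cvgrPdist_le => e e0; move/cvgr0Pnorm_le : c0 => /(_ e e0).
apply: filterS => n; apply: le_trans; rewrite distrC.
by apply: le_trans (nb n) _; exact: ler_norm.
Qed.

End L2_limits.

(** * From an inequality on the initial domain to the spectral gap of the closure *)

Section spectral_gap_bound.
Context d (T : measurableType d) (R : realType) (mu : probability T R).
Implicit Types (f g : T -> R).
Local Notation L2 := (Lfun mu 2%:E).
Local Notation I f := (\int[mu]_x f x).

Lemma expectation_Rintegral f : f \in Lfun mu 1 -> 'E_mu[f]%E = (I f)%:E.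
Proof.
move=> f1; rewrite unlock /Rintegral fineK//; apply: integrable_fin_num => //.
exact/Lfun1_integrable.
Qed.

Lemma Rintegral_prob_cst (c : R) : I (fun=> c) = c.
Proof. by rewrite /Rintegral; have := expectation_cst mu c; rewrite unlock => ->. Qed.

Lemma L2_L1 f : f \in L2 -> f \in Lfun mu 1.
Proof. by move=> f2; apply/Lfun_subset12 => //; exact: fin_num_measure. Qed.

Lemma variance_Rintegral f : f \in L2 ->
  'V_mu[f]%E = (I (fun x => f x ^+ 2) - I f ^+ 2)%:E.
Proof.
move=> f2; rewrite varianceE// (expectation_Rintegral (L2_L1 f2)).
by rewrite (expectation_Rintegral (Lfun2_mul_Lfun1 f2 f2)) EFinB.
Qed.

(** Zero variance makes the L^2 norm of f minus its mean vanish, so f is almost everywhere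
    constant. *)
Lemma variance_gt0 f : f \in L2 -> ~ (exists c : R, f = cst c %[ae mu]) ->
  0 < I (fun x => f x ^+ 2) - I f ^+ 2.
Proof.
move=> f2 fnc; have V0 := variance_ge0 mu f.
rewrite (variance_Rintegral f2) lee_fin in V0.
rewrite lt_def V0 andbT; apply/eqP => V00; apply: fnc; exists (I f).
have c2 : cst (I f) \in L2 by exact: Lfun_cst.
have fc2 : (f \- cst (I f)) \in L2 by rewrite rpredB ?lee1n.
have : ('N[mu]_2%:E[EFin \o (f \- cst (I f))%R] = 0)%E.
  rewrite N2E// (_ : Rintegral _ _ _ = 0) ?sqrtr0// -V00.
  have i1 := L2_integrable_mul f2 f2; have i2 := L2_integrable_mul f2 c2.
  have i3 := L2_integrable_mul c2 c2.
  have i12 := integrableB measurableT (integrableB measurableT i1 i2) i2.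
  rewrite (_ : (fun x => _) = (fun x => (f x * f x - f x * I f - f x * I f) + I f * I f)%R).
    rewrite (RintegralD measurableT i12 i3).
    rewrite (RintegralB measurableT (integrableB measurableT i1 i2) i2).
    rewrite (RintegralB measurableT i1 i2).
    rewrite (RintegralZr _ _ (L2_integrable f2))//.
    rewrite /= Rintegral_prob_cst.
    by rewrite /GRing.exp /=; ring.
  by apply/funext => x /=; ring.
have mf : measurable_fun setT (EFin \o (f \- cst (I f))).
  by apply/measurable_EFinP; exact: Lfun_measurable fc2.
have two0 : (0 < 2%:E :> \bar R)%E by rewrite lte_fin.
move=> /(Lnorm_eq0_eq0 mf two0); apply: filterS => x /= H _.
by apply/eqP; rewrite -subr_eq0; have := H Logic.I; move=> [->].
Qed.

(** Both sides of the inequality are L^2-continuous in h and L h, so it passes to the limits f and g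
    that define the closure. *)
Lemma spectral_gap_ge (D : set (T -> R)) (L : (T -> R) -> T -> R) (c : R) :
    (forall h, D h -> [/\ h \in L2, L h \in L2 &
      c * (I (fun x => h x ^+ 2) - I h ^+ 2) <= I (fun x => h x * - L h x)]) ->
  (c%:E <= spectral_gap mu (L2_closure mu D L))%E.
Proof.
move=> HD; apply/ereal_infP => _ [f [g [[f2 g2 [h [Dh ch cLh]]] fnc ->]]].
have h2 n : h n \in L2 by have [] := HD _ (Dh n).
have Lh2 n : L (h n) \in L2 by have [] := HD _ (Dh n).
have c1 := cvg_Rintegral_mul f2 f2 h2 h2 ch ch.
have one2 : cst 1 \in L2 by exact: Lfun_cst.
have c2 : I (h n) @[n --> \oo] --> I f.
  have -> : (fun n => I (h n)) = fun n => I (fun x => h n x * cst 1 x).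
    by apply/funext => n; under [RHS]eq_Rintegral do rewrite mulr1.
  have -> : I f = I (fun x => f x * cst 1 x).
    by under [RHS]eq_Rintegral do rewrite mulr1.
  apply: (@cvg_Rintegral_mul _ _ _ _ _ (fun=> cst 1)) => //.
  rewrite (_ : (fun n => _) = cst 0%E); first exact: cvg_cst.
  apply/funext => n; rewrite -(@Lnorm0 _ _ _ mu 2%:E)//; apply: eq_Lnorm => x /=.
  by rewrite subrr.
have c3 := cvg_Rintegral_mul f2 g2 h2 Lh2 ch cLh.
have ineq : c * (I (fun x => f x * f x) - I f ^+ 2) <= - I (fun x => f x * g x).
  apply: (@ler_cvg_to nat \oo _ R (fun n => c * (I (fun x => h n x * h n x) - I (h n) ^+ 2))
    (fun n => - I (fun x => h n x * L (h n) x))).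
  - apply: cvgM; first exact: cvg_cst.
    by apply: cvgB => //; rewrite expr2; under eq_fun do rewrite expr2; exact: cvgM.
  - exact: cvgN.
  near=> n; have [_ _] := HD _ (Dh n).
  congr (_ <= _); rewrite -mulN1r -RintegralZl//; last exact: L2_integrable_mul.
  by apply: eq_Rintegral => x _; ring.
have V0 := variance_gt0 f2 fnc.
rewrite (variance_Rintegral f2) inver gt_eqF// lee_pdivlMr// -EFinM.
have Ng2 : (\- g) \in L2 by rewrite rpredN.
rewrite (_ : (fun t => f t * - g t) = f \* (\- g)) //.
rewrite (expectation_Rintegral (Lfun2_mul_Lfun1 f2 Ng2)) lee_fin.
rewrite (_ : I (f \* \- g) = - I (fun x => f x * g x)) //.
rewrite -mulN1r -RintegralZl//; last exact: L2_integrable_mul.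
by apply: eq_Rintegral => x _ /=; ring.
Unshelve. all: by end_near. Qed.

End spectral_gap_bound.

(** * Spectral gap and critical density *)

Section constrained_model.
Context (R : realType) (V : countType) (ch N : V -> seq V) (dp : V -> nat).
Context (j k : nat) (p : R).
Hypothesis ch_uniq : forall x, uniq (ch x).
Hypothesis dp_ch : forall x y, y \in ch x -> dp y = (dp x).+1.
Hypothesis ch_inj : forall x x' y, y \in ch x -> y \in ch x' -> x = x'.
Hypothesis size_ch : forall x, size (ch x) = k.
Hypothesis N_irrefl : forall x, x \notin N x.
Hypothesis ch_N : forall x w, removable ch j 0 x w -> constraint N j x w.
Hypothesis p0 : 0 <= p.
Hypothesis p1 : p < 1.
Local Notation mu := (bernoulli_field V p).
Local Notation cN x w := (constraint N j x w).
Implicit Types (w : V -> bool) (S L : seq V) (f : (V -> bool) -> R).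

Let p01 : 0 <= p <= 1. Proof. by rewrite p0 ltW. Qed.

Lemma eq_constraint x w w' : {in N x, w =1 w'} -> cN x w = cN x w'.
Proof.
move=> ww'; rewrite /constraint; congr (_ <= _)%N.
by rewrite big_seq [RHS]big_seq; apply: eq_bigr => y yx; rewrite ww'.
Qed.

Lemma indep_constraint x : indep x (fun w => (cN x w)%:R : R).
Proof.
move=> w b; congr (nat_of_bool _)%:R; apply: eq_constraint => y yx.
by rewrite upd_neq//; apply: contraTneq yx => ->.
Qed.

Lemma local_generatorE f S L w : depends_on S f -> uniq L -> {subset S <= L} ->
  local_generator N j p f w = \sum_(x <- L) (cN x w)%:R * (av p x f w - f w).
Proof.
move=> dS uL SL; rewrite /local_generator.
rewrite (@fsbigE _ _ _ _ _ L)//; last first.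
  move=> x _ xL; rewrite site_averageE// (@av_id _ _ _ x f) ?subrr ?mulr0//.
  by apply: (depends_on_indep dS); apply: contra xL => /SL.
by apply: eq_big => [x|x _]; [rewrite in_setT|rewrite site_averageE].
Qed.

Lemma depends_on_generator f S : depends_on S f -> uniq S ->
  depends_on (S ++ flatten [seq N x | x <- S]) (local_generator N j p f).
Proof.
move=> dS uS w w' ww'; rewrite !(@local_generatorE f S S)//.
rewrite big_seq [RHS]big_seq; apply: eq_bigr => x xS.
have wS : {in S, w =1 w'} by move=> y yS; apply: ww'; rewrite mem_cat yS.
have wb b : f (upd w x b) = f (upd w' x b).
  by apply: dS => y yS; rewrite /upd; case: eqP => // _; exact: wS.
rewrite /av !wb (dS w w')//; congr ((nat_of_bool _)%:R * _).
apply: eq_constraint => y yx; apply: ww'; rewrite mem_cat; apply/orP; right.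
by apply/flatten_mapP; exists x.
Qed.

(** The constraint at x does not look at x, so averaging at x first turns f (f - av x f) into the
    variance of f at x. *)
Lemma dirichlet_local f S L w : depends_on S f -> uniq S -> {subset S <= L} ->
  avs p L (fun v => f v * - local_generator N j p f v) w =
  \sum_(x <- S) avs p L (fun v => (cN x v)%:R * (p * (1 - p) * grad x f v ^+ 2)) w.
Proof.
move=> dS uS SL.
rewrite (_ : (fun v => _) = fun v => \sum_(x <- S)
    (cN x v)%:R * (f v ^+ 2 - f v * av p x f v)); last first.
  apply/funext => v; rewrite (local_generatorE v dS uS)// -sumrN mulr_sumr.
  by apply: eq_bigr => x _; ring.
rewrite avs_sum big_seq [RHS]big_seq; apply: eq_bigr => x xS.
rewrite -(avs_mem _ _ (SL x xS)); congr (avs _ _ _ _); apply/funext => v.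
rewrite avM; last exact: indep_constraint.
by congr (_ * _); rewrite /av /grad !upd_upd; ring.
Qed.

Lemma var_eq0 s f w : p = 0 -> var p s f w = 0.
Proof.
move=> pz; elim: s w => [|x s IHs] w; first by rewrite /var /= subrr.
by rewrite var_cons /av !IHs pz; ring.
Qed.

(** The Poincare inequality concerns the constraints along [ch]; by [ch_N] those along N hold more
    often, which only enlarges the Dirichlet form. *)
Lemma gap_gt0 n (e : R) : 0 <= e -> 16 * e * n.+2%:R <= 2^-1 ->
    (forall x w, avs p (below ch n x) (fun u => (~~ removable ch j n x u)%:R) w <= e) ->
  (0 < gap N j p)%E.
Proof.
move=> e0 en he.
have [c [c0 Hc]] : exists c : R, 0 < c /\ forall S L f w,
    depends_on S f -> uniq S -> uniq L -> {subset S <= L} ->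
    {in S, forall x, {subset subtree ch n.+1 x <= L}} ->
    c * var p L f w <= \sum_(x <- S)
      avs p L (fun v => (cN x v)%:R * (p * (1 - p) * grad x f v ^+ 2)) w.
  (* At p = 0 all variances vanish; the comparison of flips divides by p and is used for p > 0. *)
  have [pz|pn] := eqVneq p 0.
    exists 1; split => // S L f w *; rewrite var_eq0// mulr0.
    apply: sumr_ge0 => x _; apply: avs_ge0 => // v.
    by rewrite pz !mul0r mulr0.
  have p01' : 0 < p < 1 by rewrite lt_def pn p0.
  have [C [C0 HC]] := poincare_local ch_uniq dp_ch ch_inj size_ch p01' e0 en he.
  have pq0 : 0 < p * (1 - p) by rewrite mulr_gt0 ?subr_gt0//; case/andP: p01'.
  have C1 : 0 < C + 1 by rewrite ltr_wpDl.
  (* C may be 0, hence the C + 1. *)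
  exists (p * (1 - p) / (C + 1)); split; first exact: divr_gt0.
  move=> S L f w dS uS uL SL subL; have := HC S L f w dS uS uL SL subL.
  set E := \sum_(x <- S) energy _ _ _ _ _ _ _ _; move=> H.
  have E0 : 0 <= E by apply: sumr_ge0 => x _; exact: energy_ge0.
  apply: (@le_trans _ _ (p * (1 - p) * E)).
    rewrite -mulrA ler_pM2l// ler_pdivrMl//.
    by apply: le_trans H _; rewrite ler_wpM2r// lerDl.
  rewrite /E mulr_sumr; apply: ler_sum => x _; rewrite /energy -avsZ.
  apply: le_avs => // v; rewrite mulrCA; apply: ler_wpM2r.
    by rewrite mulr_ge0 ?sqr_ge0// ltW.
  by rewrite ler_nat; case: (removable _ _ _ _ _) (@ch_N x v) => // /(_ isT) ->.
apply: (@lt_le_trans _ _ c%:E); first by rewrite lte_fin.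
apply: spectral_gap_ge => f [S0 dS0].
pose S := undup S0.
have dS : depends_on S f.
  by move=> w w' ww'; apply: dS0 => x xS; apply: ww'; rewrite mem_undup.
have uS : uniq S by exact: undup_uniq.
pose T := S ++ flatten [seq N x | x <- S].
have dL : depends_on T (local_generator N j p f) by exact: depends_on_generator.
have f2 : f \in Lfun mu 2%:E.
  have [M HM] := local_bounded dS; apply: bounded_L2 HM.
  exact: measurable_local dS.
have Lf2 : local_generator N j p f \in Lfun mu 2%:E.
  have [M HM] := local_bounded dL; apply: bounded_L2 HM.
  exact: measurable_local dL.
split => //.
(* A finite volume containing the sites on which f and its image depend, and the subtrees used by
   the legal moves. *)
pose L := undup (T ++ flatten [seq subtree ch n.+1 x | x <- S]).
have uL : uniq L by exact: undup_uniq.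
have TL : {subset T <= L} by move=> x xT; rewrite mem_undup mem_cat xT.
have SL : {subset S <= L} by move=> x xS; apply: TL; rewrite mem_cat xS.
have subL : {in S, forall x, {subset subtree ch n.+1 x <= L}}.
  move=> x xS y yx; rewrite mem_undup mem_cat; apply/orP; right.
  by apply/flatten_mapP; exists x.
pose w0 : V -> bool := fun=> true.
have dfL := depends_onW SL dS; have dLL := depends_onW TL dL.
rewrite !(@Rintegral_local _ _ _ p01 L _ w0)//.
- rewrite (dirichlet_local w0 dS uS SL); exact: Hc.
- by move=> w w' ww'; rewrite (dfL w w' ww') (dLL w w' ww').
- by move=> w w' ww'; rewrite (dfL w w' ww').
Qed.

End constrained_model.

(** * A nonconstant kernel element built from a stable fixed point *)

Section percolation.
Context (R : realType) (V : countType) (ch : V -> seq V) (dp : V -> nat).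
Context (j m k : nat) (p l : R).
Hypothesis ch_uniq : forall x, uniq (ch x).
Hypothesis dp_ch : forall x y, y \in ch x -> dp y = (dp x).+1.
Hypothesis ch_inj : forall x x' y, y \in ch x -> y \in ch x' -> x = x'.
Hypothesis size_ch : forall x, size (ch x) = k.
Hypothesis jmk : (j + m)%N = k.+1.
Hypothesis p0 : 0 < p.
Hypothesis p1 : p < 1.
Hypothesis l01 : 0 < l < 1.
Hypothesis fixl : p * tail m k l = l.
Hypothesis stable : p * dtail m k l < 1.
Hypothesis cvgl : survival m k p 1 n @[n --> \oo] --> l.
Local Notation mu := (bernoulli_field V p).
Local Notation I f := (\int[mu]_w f w).

Let p01 : 0 <= p <= 1. Proof. by rewrite !ltW. Qed.

Lemma constraint_removable x w : constraint ch j x w = removable ch j 0 x w.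
Proof.
rewrite /constraint /removable; congr (_ <= _)%N.
rewrite -sumn_count sumnE big_map; apply: eq_bigr => y _ /=.
by case: (w y).
Qed.

Lemma emptied_le n x w : emptied ch j n x w -> emptied ch j n.+1 x w.
Proof.
elim: n x => [|n IHn] x; first by rewrite /= orbF => ->.
rewrite !emptiedS => /orP[->//|rx]; apply/orP; right.
by apply: leq_trans rx _; apply: sub_count => y; exact: IHn.
Qed.

(** The conditional survival probability of an occupied vertex in the stationary regime; with this
    boundary value [psi] has mean l for every n. *)
Let a := tail m k l.

Let l01W : 0 <= l <= 1. Proof. by case/andP: l01 => ? ?; rewrite !ltW. Qed.

Let a01 : 0 <= a <= 1.
Proof. by have [h1 h2 _] := tail_bounds m k l01W; rewrite h1 h2. Qed.

Let one01 : 0 <= (1 : R) <= 1. Proof. by rewrite ler01 lexx. Qed.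

Let survivalE n : survival m k p a n = l.
Proof. by elim: n => [|n IHn] /=; rewrite ?IHn /a fixl. Qed.

Variable x : V.

Let h n : config V -> R := psi ch m a n x.
Let u n : config V -> R := psi ch m 1 n x.
Let A := \bigcap_n [set w : config V | u n w = 1].
Let f : config V -> R := \1_A.

Let uE n w : u n w = (~~ emptied ch j n x w)%:R.
Proof. exact: (psi1E size_ch jmk p01). Qed.

Let dep_h n : depends_on (subtree ch n x) (h n).
Proof. by move=> w w'; exact: eq_psi. Qed.

Let dep_u n : depends_on (subtree ch n x) (u n).
Proof. by move=> w w'; exact: eq_psi. Qed.

Let uniq_sub n y : uniq (subtree ch n y).
Proof. exact: (uniq_subtree ch_uniq dp_ch ch_inj). Qed.

Let mAn n : measurable [set w : config V | u n w = 1].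
Proof.
rewrite (_ : [set w | _] = u n @^-1` [set 1]); last by [].
have mu_ := @measurable_local R V _ _ (@dep_u n).
by have := mu_ measurableT [set 1] (measurable_set1 _); rewrite setTI.
Qed.

Let mA : measurable A.
Proof. by apply: bigcap_measurableType => n _; exact: mAn. Qed.

Let Iu n : I (u n) = survival m k p 1 n.
Proof.
rewrite (Rintegral_local p01 (fun=> true) (uniq_sub n x) (@dep_u n)).
exact: (avs_psi m ch_uniq dp_ch ch_inj size_ch).
Qed.

Let Ih n : I (h n) = l.
Proof.
rewrite (Rintegral_local p01 (fun=> true) (uniq_sub n x) (@dep_h n)).
by rewrite -(survivalE n); exact: (avs_psi m ch_uniq dp_ch ch_inj size_ch).
Qed.

Let mu_u n : mu [set w : config V | u n w = 1] = (I (u n))%:E.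
Proof.
rewrite /Rintegral fineK; last first.
  by apply: integrable_fin_num => //; exact: (integrable_local _ (@dep_u n)).
have := integral_indic mu measurableT (@mAn n); rewrite setIT => <-.
apply: eq_integral => w _ /=.
congr EFin; rewrite indicE uE; have [E|E] /= := boolP (emptied ch j n x w).
  by rewrite memNset// /= uE E => /eqP; rewrite eq_sym oner_eq0.
by rewrite mem_set//= uE E.
Qed.

(** Continuity from above along the decreasing events of survival up to step n. *)
Let mu_A : mu A = l%:E.
Proof.
have ni : nonincreasing_seq (fun n => [set w : config V | u n w = 1]).
  apply/nonincreasing_seqP => n; apply/subsetPset => w /=.
  rewrite !uE; have [E|E] := boolP (emptied ch j n x w).
    by rewrite (emptied_le E) => ->.
  by [].
have cA := nonincreasing_cvg_mu _ mAn mA ni.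
have {}cA : (mu \o (fun n => [set w : config V | u n w = 1])) @ \oo --> mu A.
  apply: cA; apply: le_lt_trans (probability_le1 _ _) _ => //; exact: ltry.
apply: (cvg_unique _ cA) => //.
rewrite (_ : _ \o _ = EFin \o (fun n => survival m k p 1 n)).
  by apply: cvg_EFin => //; near=> n.
by apply/funext => n /=; rewrite -Iu -mu_u.
Unshelve. all: by end_near. Qed.

Let f2 : f \in Lfun mu 2%:E.
Proof.
apply: (@bounded_L2 _ _ _ _ _ 1); first exact: measurable_indic.
by move=> w; rewrite /f indicE; case: (_ \in _); rewrite ?normr1 ?normr0 ?ler01.
Qed.

Let If : I f = l.
Proof.
rewrite /Rintegral /f integral_indic// setIT.
by have := congr1 fine mu_A.
Qed.

Let h2 n : h n \in Lfun mu 2%:E.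
Proof.
apply: (@bounded_L2 _ _ _ _ _ 1); first exact: measurable_local (@dep_h n).
move=> w; have /andP[h0 h1] := psi_bounds ch m n x w a01.
by rewrite ger0_norm.
Qed.

Let u2 n : u n \in Lfun mu 2%:E.
Proof.
apply: (@bounded_L2 _ _ _ _ _ 1); first exact: measurable_local (@dep_u n).
move=> w; have /andP[h0 h1] := psi_bounds ch m n x w one01.
by rewrite ger0_norm.
Qed.

(** Yields L^2 convergence from means alone: both terms on the right have mean
    [survival m k p 1 n - l], which tends to 0. *)
Let h_sub_f n w : (h n w - f w) ^+ 2 <= (u n w - h n w) + (u n w - f w).
Proof.
have /andP[h0 h1] := psi_bounds ch m n x w a01.
have hu : h n w <= u n w by exact: le_psi.
rewrite /f indicE; have [/set_mem /(_ n Logic.I) /= ->|_] := boolP (w \in A).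
  rewrite /=; move: h0 h1; rewrite -/(h n w); move: (h n w) => t t0 t1; nra.
rewrite /= !subr0; move: h0 h1 hu; rewrite -/(h n w); move: (h n w) (u n w) => t v.
by nra.
Qed.

Let cvg_h : (fun n => 'N[mu]_2%:E [EFin \o (h n \- f)%R])%E @ \oo --> 0%E.
Proof.
apply: cvg_N2; first by move=> n; rewrite rpredB ?lee1n.
have c2 : (survival m k p 1 n - l) + (survival m k p 1 n - l) @[n --> \oo] --> 0.
  rewrite [X in _ --> X](_ : 0 = (l - l) + (l - l)); last by ring.
  by apply: cvgD; apply: cvgB => //; exact: cvg_cst.
apply: (squeeze_cvgr _ (cvg_cst (0 : R)) c2); near=> n; apply/andP; split.
  by apply: Rintegral_ge0 => w _; exact: sqr_ge0.
have iu := L2_integrable (u2 n); have ih := L2_integrable (h2 n).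
have if_ := L2_integrable f2.
have i1 := integrableB measurableT iu ih; have i2 := integrableB measurableT iu if_.
rewrite -{1}(Ih n) -If -Iu -(RintegralB measurableT iu ih).
rewrite -(RintegralB measurableT iu if_) -(RintegralD measurableT i1 i2).
apply: le_Rintegral => //; last by move=> w _; exact: h_sub_f.
- by apply: Lfun2_integrable_sqr; rewrite rpredB ?lee1n.
- exact: (integrableD measurableT i1 i2).
Unshelve. all: by end_near. Qed.

Let drift n : config V -> R := psi_drift ch j m p a n x.

Let dep_drift n : depends_on (subtree ch n.+1 x) (drift n).
Proof. by move=> w w'; exact: eq_psi_drift. Qed.

Let ch_irrefl y : y \notin ch y.
Proof. by apply/negP => /dp_ch /eqP; rewrite -[X in X == _]addn0 -addn1 eqn_add2l. Qed.

Let generator_h n : local_generator ch j p (h n) = drift n.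
Proof.
apply/funext => w.
rewrite (@local_generatorE _ _ _ _ _ (ltW p0) p1 _ _ _ w (@dep_h n) (uniq_sub n x))//.
rewrite /drift -(finite_generator_psi ch_uniq dp_ch ch_inj size_ch jmk p01).
by apply: eq_bigr => y _; rewrite constraint_removable.
Qed.

Let drift2 n : drift n \in Lfun mu 2%:E.
Proof.
have [M HM] := local_bounded (@dep_drift n); apply: bounded_L2 HM.
exact: measurable_local (@dep_drift n).
Qed.

Let cvg_drift : I (fun w => drift n w ^+ 2) @[n --> \oo] --> (0 : R).
Proof.
(* Stability means rho < 1; sigma is the midpoint between rho and 1. *)
pose rho := p * dtail m k l; pose sigma := (1 + rho) / 2.
have rho0 : 0 <= rho.
  apply: mulr_ge0; first exact: ltW.
  by have /andP[] := dtail_bounds m k l01W.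
have rs : rho < sigma by rewrite /sigma; move: stable; rewrite -/rho; lra.
have s1 : sigma < 1 by rewrite /sigma; move: stable; rewrite -/rho; lra.
have s0 : 0 <= sigma by rewrite (le_trans rho0)// ltW.
pose K := 1 + 4 * k%:R ^+ 2 / (sigma - rho).
have cK : K * sigma ^+ n @[n --> \oo] --> 0.
  rewrite -[X in _ --> X](mulr0 K); apply: cvgM; first exact: cvg_cst.
  by apply: cvg_expr; rewrite ger0_norm.
apply: (squeeze_cvgr _ (cvg_cst (0 : R)) cK); near=> n; apply/andP; split.
  by apply: Rintegral_ge0 => w _; exact: sqr_ge0.
have dd : depends_on (subtree ch n.+1 x) (fun w => drift n w ^+ 2).
  by move=> w w' ww'; rewrite (@dep_drift n w w').
rewrite (Rintegral_local p01 (fun=> true) (uniq_sub n.+1 x) dd).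
apply: (drift_sqr j ch_uniq dp_ch ch_inj size_ch p01 a01 survivalE) => //.
exact: ltW.
Unshelve. all: by end_near. Qed.

Let generator_f : generator ch j p f (fun t => 0 * f t).
Proof.
have z2 : (fun t => 0 * f t) \in Lfun mu 2%:E.
  rewrite (_ : (fun t => _) = cst 0); first exact: Lfun_cst.
  by apply/funext => t; rewrite mul0r.
split => //; exists h; split => //.
  by move=> n; exists (subtree ch n x) => w w' ww'; exact: dep_h.
apply: cvg_N2; first by move=> n; rewrite generator_h rpredB ?lee1n.
rewrite (_ : (fun n => _) = fun n => I (fun w => drift n w ^+ 2)) //.
apply/funext => n; apply: eq_Rintegral => w _.
by rewrite generator_h /= mul0r subr0.
Qed.

Let generator_cst1 : generator ch j p (cst 1) (fun t => 0 * cst 1 t).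
Proof.
have z2 : (fun t : config V => 0 * cst (1 : R) t) \in Lfun mu 2%:E.
  rewrite (_ : (fun t => _) = cst 0); first exact: Lfun_cst.
  by apply/funext => t; rewrite mul0r.
have L1 : local_generator ch j p (cst 1) = cst 0.
  apply/funext => w; rewrite (@local_generatorE _ _ _ _ _ (ltW p0) p1 _ [::] [::])//.
  by rewrite big_nil.
split => //; first exact: Lfun_cst.
exists (fun=> cst 1); split.
- by move=> n; exists [::].
- rewrite (_ : (fun n => _) = cst 0%E); first exact: cvg_cst.
  apply/funext => n; rewrite -(@Lnorm0 _ _ _ mu 2%:E)//; apply: eq_Lnorm => w /=.
  by rewrite subrr.
- rewrite (_ : (fun n => _) = cst 0%E); first exact: cvg_cst.
  apply/funext => n; rewrite -(@Lnorm0 _ _ _ mu 2%:E)//; apply: eq_Lnorm => w /=.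
  by rewrite L1 /= mul0r subrr.
Qed.

Let ae_Rintegral (g1 g2 : config V -> R) : measurable_fun setT g1 ->
  measurable_fun setT g2 -> g1 = g2 %[ae mu] -> I g1 = I g2.
Proof.
move=> m1 m2 g12; rewrite /Rintegral; congr fine.
apply: ae_eq_integral => //; [exact/measurable_EFinP|exact/measurable_EFinP|].
by apply: filterS g12 => w /= H _; rewrite H.
Qed.

(** If f = c f0 and 1 = d f0 almost everywhere, then d f = c, and multiplying by f also d f = c f
    since f is an indicator. Integrating, d l = c = c l with 0 < l < 1, so c = d = 0, which
    contradicts 1 = d f0. *)
Lemma not_simple_eigenvalue : ~ simple_eigenvalue mu (generator ch j p) 0.
Proof.
move=> [f0 [_ _ H]].
have [c Hc] := H _ generator_f; have [d Hd] := H _ generator_cst1.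
have mf : measurable_fun setT f by exact: measurable_indic.
have sqf w : f w * f w = f w.
  by rewrite /f indicE; case: (_ \in _); rewrite ?mul1r ?mul0r.
have H1 : d * l = c.
  rewrite -(Rintegral_prob_cst mu c) -If -RintegralZl//; last exact: L2_integrable.
  apply: ae_Rintegral => //; first exact: measurable_funM.
  apply: filterS2 Hc Hd => w /= Hc Hd _.
  by rewrite (Hc Logic.I) mulrCA -(Hd Logic.I) mulr1.
have H2 : d * l = c * l.
  rewrite -If -!RintegralZl//; [|exact: L2_integrable..].
  apply: ae_Rintegral; [exact: measurable_funM|exact: measurable_funM|].
  apply: filterS2 Hc Hd => w /= Hc Hd _.
  rewrite -{1}sqf {1}(Hc Logic.I).
  rewrite (_ : d * _ = c * (d * f0 w) * f w); last by ring.
  by rewrite -(Hd Logic.I) mulr1.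
case/andP: l01 => l0 l1.
have cz : c = 0.
  have : c * (1 - l) = 0 by rewrite mulrBr mulr1 -H2 H1 subrr.
  by move/eqP; rewrite mulf_eq0 subr_eq0 (gt_eqF l1) orbF => /eqP.
have dz : d = 0.
  by move/eqP: H1; rewrite cz mulf_eq0 (gt_eqF l0) orbF => /eqP.
have : I (cst 1) = I (cst 0).
  apply: ae_Rintegral => //.
  by apply: filterS Hd => w /= Hd _; rewrite (Hd Logic.I) dz mul0r.
by rewrite !Rintegral_prob_cst => /eqP; rewrite oner_eq0.
Qed.

End percolation.

(** * Exponential decay of the survival probabilities *)

Section subcritical.
Context (R : realType).

(** r^n is the smallest of the n + 1 terms of the geometric sum 1 + r + ... + r^n. *)
Lemma arithmetico_geometric_le (r : R) n : 0 <= r <= 1 ->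
  n.+1%:R * r ^+ n * (1 - r) <= 1 - r ^+ n.+1.
Proof.
move=> /andP[r0 r1]; elim: n => [|n IHn]; first by rewrite !expr0 expr1; lra.
have h : 0 <= (1 - r) * (1 - r ^+ n.+1).
  by rewrite mulr_ge0 ?subr_ge0// exprn_ile1.
have h1 := ler_wpM2l r0 IHn.
have -> : n.+2%:R * r ^+ n.+1 * (1 - r) =
    r * (n.+1%:R * r ^+ n * (1 - r)) + r ^+ n.+1 * (1 - r).
  by rewrite -[n.+2%:R]natr1 exprS; ring.
rewrite [r ^+ n.+2]exprS; lra.
Qed.

(** The bound at p1 makes each step at p contract by r = p / p1, and a geometric decay beats the
    linear factor n + 2. *)
Lemma survival_small m k (p p1 : R) : 0 <= p -> p < p1 -> p1 <= 1 ->
    (forall l, 0 <= l <= 1 -> p1 * tail m k l <= l) ->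
  exists n e, [/\ 0 <= e, 16 * e * n.+2%:R <= 2^-1 &
    tail m k (survival m k p 1 n) <= e].
Proof.
move=> p0 pp1 p11 Hp; have p10 : 0 < p1 by exact: le_lt_trans pp1.
have p01 : 0 <= p <= 1 by rewrite p0 (le_trans (ltW pp1)).
have u01 n : 0 <= survival m k p 1 n <= 1.
  by apply: survival_bounds => //; rewrite ler01 lexx.
pose r := p / p1.
have r0 : 0 <= r by rewrite divr_ge0// ltW.
have r1 : r < 1 by rewrite ltr_pdivrMr// mul1r.
have tE n : tail m k (survival m k p 1 n) <= survival m k p 1 n / p1.
  by rewrite ler_pdivlMr// mulrC; exact: Hp.
have un n : survival m k p 1 n <= r ^+ n.
  elim: n => [|n IHn]; first by rewrite /= mulr1; case/andP: p01.
  apply: (@le_trans _ _ (r * survival m k p 1 n)).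
    by rewrite /r -mulrA ler_wpM2l// mulrC; exact: tE.
  by rewrite exprS ler_wpM2l.
have d0 : 0 < (1 - r) * p1 / 64 by rewrite divr_gt0// mulr_gt0// subr_gt0.
have [n hn] : exists n, r ^+ n <= (1 - r) * p1 / 64.
  have cr : r ^+ n @[n --> \oo] --> 0 by apply: cvg_expr; rewrite ger0_norm.
  move/cvgr0Pnorm_le : cr => /(_ _ d0) [n _ /(_ n (leqnn n))] /= hn.
  by exists n; rewrite (le_trans _ hn)// ler_norm.
(* With 2n steps, one factor r^n compensates 2n + 2 and the other is small; 64 is chosen so that 32
   / 64 = 1/2. *)
exists (n + n)%N, (r ^+ (n + n) / p1); split.
- by rewrite divr_ge0 ?exprn_ge0// ltW.
- have H := @arithmetico_geometric_le r n (introT andP (conj r0 (ltW r1))).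
  have rn0 : 0 <= r ^+ n by exact: exprn_ge0.
  have H2 : n.+1%:R * r ^+ n * (1 - r) <= 1.
    by apply: le_trans H _; rewrite lerBlDr lerDl exprn_ge0.
  have h3 : r ^+ n * p1^-1 / (1 - r) <= 64^-1.
    rewrite ler_pdivrMr ?subr_gt0// ler_pdivrMr//.
    by apply: le_trans hn _; rewrite le_eqVlt; apply/orP; left; apply/eqP; ring.
  have q0 : 0 < 1 - r by rewrite subr_gt0.
  have -> : 16 * (r ^+ (n + n) / p1) * (n + n).+2%:R =
      32 * ((r ^+ n * p1^-1 / (1 - r)) * (n.+1%:R * r ^+ n * (1 - r))).
    have -> : (n + n).+2%:R = n.+1%:R + n.+1%:R :> R by rewrite -natrD addSn addnS.
    rewrite exprD; move: (r ^+ n) (n.+1%:R : R) => b c.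
    by field; rewrite !gt_eqF.
  have h4 := ler_pM (divr_ge0 (mulr_ge0 rn0 _) (ltW q0)) _ h3 H2.
  have {}h4 : r ^+ n * p1^-1 / (1 - r) * (n.+1%:R * r ^+ n * (1 - r)) <= 64^-1 * 1.
    apply: h4; first by rewrite invr_ge0 ltW.
    by rewrite !mulr_ge0// ltW.
  lra.
apply: le_trans (tE _) _.
by rewrite ler_pM2r ?invr_gt0.
Qed.

End subcritical.

(** * Orientations of the two trees *)

Section trees.
Context (k : nat).

Lemma size_in_children (x y : rooted_tree k) : y \in children x ->
  size y = (size x).+1.
Proof. by move=> /mapP[i _ ->]. Qed.

Lemma children_inj (x x' y : rooted_tree k) :
  y \in children x -> y \in children x' -> x = x'.
Proof. by move=> /mapP[i _ ->] /mapP[i' _ []]. Qed.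

Lemma children_irrefl (x : rooted_tree k) : x \notin children x.
Proof. by apply/negP => /size_in_children; lia. Qed.

(* The orientation of the regular tree away from its central edge. *)
Definition outer (x : regular_tree k) : seq (regular_tree k) :=
  [seq (x.1, i :: x.2) | i <- enum 'I_k].

Lemma outer_uniq x : uniq (outer x).
Proof. by rewrite map_inj_uniq ?enum_uniq// => i i' []. Qed.

Lemma size_outer x : size (outer x) = k.
Proof. by rewrite size_map size_enum_ord. Qed.

Lemma size_in_outer x y : y \in outer x -> size y.2 = (size x.2).+1.
Proof. by move=> /mapP[i _ ->]. Qed.

Lemma outer_inj x x' y : y \in outer x -> y \in outer x' -> x = x'.
Proof.
by case: x x' => [c s] [c' s'] /mapP[i _ ->] /mapP[i' _ [-> _ ->]].
Qed.

Lemma neighbors_irrefl (x : regular_tree k) : x \notin neighbors x.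
Proof.
case: x => c s; rewrite /neighbors in_cons negb_or; apply/andP; split; last first.
  by apply/negP => /mapP[i _ [sE]]; have := congr1 size sE; rewrite /=; lia.
case: s => [|i s]; first by apply/eqP => -[]; case: c.
by apply/eqP => -[sE]; have := congr1 size sE; rewrite /=; lia.
Qed.

(** Adding the inner neighbor back can only increase the number of empty neighbors. *)
Lemma outer_constraint j x w :
  removable outer j 0 x w -> constraint (@neighbors k) j x w.
Proof.
rewrite -constraint_removable /constraint => /leq_trans; apply.
case: x => c s; rewrite /neighbors big_cons; exact: leq_addl.
Qed.

End trees.

(** Take p2 > p at which 0 is simple and p1 halfway. If p1 tail(l) > l for some l, the percolation
    event would give a second kernel element at p2. *)
Lemma OFA_subcritical (R : realType) (k j : nat) (p : R) : (0 < j)%N -> (j <= k)%N ->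
    0 <= p -> p < OFA_critical_density R k j ->
  exists p1, [/\ p < p1, p1 <= 1 &
    forall l, 0 <= l <= 1 -> p1 * tail (k.+1 - j) k l <= l].
Proof.
move=> j0 jk p0 pc.
have [p2 [/andP[p20 p21] simple] pp2] : exists2 p2, (0 <= p2 < 1 /\
    simple_eigenvalue (bernoulli_field (rooted_tree k) p2)
      (generator (@children k) j p2) 0) & p < p2.
  move: pc; rewrite /OFA_critical_density /critical_density.
  set S := [set _ | _] => pc.
  (* The supremum of the empty set is 0 by convention, which 0 <= p < sup excludes. *)
  have [S0|/set0P Sn] := eqVneq S set0.
    by move: pc; rewrite S0 sup0 ltNge p0.
  have [x Sx px] := sup_gt Sn pc.
  by exists x.
pose p1 := (p + p2) / 2.
have pp1 : p < p1 by rewrite /p1; lra.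
have p12 : p1 < p2 by rewrite /p1; lra.
exists p1; split => //; first by rewrite ltW// (lt_trans p12).
move=> l /andP[l0 l1]; rewrite leNgt; apply/negP => lt.
(* [tail] vanishes at 0 because its threshold k + 1 - j is at least 1. *)
have ln : 0 < l.
  rewrite lt_def l0 andbT; apply/eqP => lz; move: lt; rewrite lz.
  rewrite /tail (@atleast_eq0 _ _ (nseq k 0)) ?mulr0 ?ltxx//.
  by rewrite count_nseq eqxx mul0n subn_gt0 ltnS.
have mk : (k.+1 - j <= k)%N by rewrite leq_subLR -add1n leq_add2r.
have [l2 [l201 fixl stable cvgl]] := survival_cvg mk (le_lt_trans p0 pp1) p12 p21 ln l1 (ltW lt).
have jmk : (j + (k.+1 - j))%N = k.+1 by rewrite subnKC// leqW.
have p20' := le_lt_trans p0 pp2.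
exact: (@not_simple_eigenvalue R (rooted_tree k) (@children k) size j _ k p2 l2
  (@children_uniq k) (@size_in_children k) (@children_inj k) (@size_children k)
  jmk p20' p21 l201 fixl stable cvgl [::]).
Qed.

Theorem theorem2 (R : realType) (k j : nat) (j_gt0 : (0 < j)%N)
    (j_le_k : (j <= k)%N) (p : R) (p_ge0 : 0 <= p)
    (p_lt_pc : p < FA_critical_density R k j)
    (p_lt_pc_bar : p < OFA_critical_density R k j) :
  (0 < FA_gap k j p)%E /\ (0 < OFA_gap k j p)%E.
Proof.
have [p1 [pp1 p11 Hp]] := OFA_subcritical j_gt0 j_le_k p_ge0 p_lt_pc_bar.
have [n [e [e0 en he]]] := survival_small p_ge0 pp1 p11 Hp.
have jmk : (j + (k.+1 - j))%N = k.+1 by rewrite subnKC// leqW.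
have p_lt1 := lt_le_trans pp1 p11.
have p01 : 0 <= p <= 1 by rewrite p_ge0 ltW.
split.
  (* The same n and e serve both models, since the law of removability depends only on the number k
     of children. Here the orientation [outer] stands for [ch], the full neighborhoods for N, and
     word length is the depth. *)
  apply: (@gap_gt0 R (regular_tree k) (@outer k) (@neighbors k)
    (fun x => size x.2) j k p (@outer_uniq k) (@size_in_outer k) (@outer_inj k)
    (@size_outer k) (@neighbors_irrefl k) (@outer_constraint k j) p_ge0 p_lt1 n e) => //.
  move=> x w; rewrite (avs_removable (@outer_uniq k) (@size_in_outer k)
    (@outer_inj k) (@size_outer k) jmk p01); exact: he.
apply: (@gap_gt0 R (rooted_tree k) (@children k) (@children k) size j k p
  (@children_uniq k) (@size_in_children k) (@children_inj k) (@size_children k)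
  (@children_irrefl k) _ p_ge0 p_lt1 n e) => //.
  by move=> x w; rewrite constraint_removable.
move=> x w; rewrite (avs_removable (@children_uniq k) (@size_in_children k)
  (@children_inj k) (@size_children k) jmk p01); exact: he.
Qed.
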